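(* Let $\mu\neq\delta_0$ be a probability measure on $[0,+\infty)$ and let $t>1$ be real. Let $\mu_t$ be the probability measure on $[0,+\infty)$, $\mu_t\neq\delta_0$, characterized by $\Sigma_{\mu_t}(z)=\Sigma_\mu(z)^t$ for all $z<0$ sufficiently close to $0$. If $0\le a<b$ are both atoms of $\mu_t$ (i.e. $\mu_t(\{a\})>0$ and $\mu_t(\{b\})>0$), then $\mu_t((a,b))>0$.
   Context: Let $\Omega=\mathbb{C}\setminus[0,+\infty)$. For a probability measure $\nu\neq\delta_0$ on $[0,+\infty)$ define, for $z\in\Omega$, $\psi_\nu(z)=\int_{[0,\infty)}\frac{zs}{1-zs}\,d\nu(s)$ and $\eta_\nu(z)=\frac{\psi_\nu(z)}{1+\psi_\nu(z)}$. The function $\eta_\nu$ maps some interval $(-\alpha,0)$ injectively, and its inverse $\eta_\nu^{-1}$ is defined on a neighborhood of some interval $(-\alpha',0)$; one sets $\Sigma_\nu(z)=\eta_\nu^{-1}(z)/z$ there (the $S$-transform-type function; free multiplicative convolution satisfies $\Sigma_{\nu_1\boxtimes\nu_2}=\Sigma_{\nu_1}\Sigma_{\nu_2}$). For $z<0$ near $0$, $\Sigma_\mu(z)>0$, and $\Sigma_\mu(z)^t$ denotes the positive power. It is known (Belinschi–Bercovici) that for every $t>1$ there exists a unique probability measure $\mu_t\neq\delta_0$ on $[0,+\infty)$ with $\Sigma_{\mu_t}=\Sigma_\mu^t$ for $z<0$ near $0$; this interpolates $\mu^{\boxtimes n}$. *)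

(* Defs.v *)
From HB Require Import structures.
From mathcomp Require Import all_boot all_order all_algebra.
From mathcomp Require Import all_classical all_reals all_analysis.
Set Implicit Arguments. Unset Strict Implicit. Unset Printing Implicit Defensive.
Import Order.TTheory GRing.Theory Num.Theory.
Local Open Scope classical_set_scope.
Local Open Scope ring_scope.

(* A probability measure on [0,+oo) is modelled as a probability measure on
   (the Borel sets of) R giving full mass to [0,+oo). *)
Definition supported_nonneg (R : realType) (nu : probability R R) : Prop :=
  nu `[0, +oo[%classic = 1%E.

Definition not_delta0 (R : realType) (nu : probability R R) : Prop :=
  nu [set 0] != 1%E.

Definition psi (R : realType) (nu : probability R R) (z : R) : R :=
  Rintegral nu `[0, +oo[%classic (fun s => z * s / (1 - z * s)).

Definition eta (R : realType) (nu : probability R R) (z : R) : R :=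
  psi nu z / (1 + psi nu z).

(* Sigma_at nu w s  :<->  s = Sigma_nu(w) = eta_nu^{-1}(w) / w, where the
   inverse is taken among negative reals (eta_nu is injective there). *)
Definition Sigma_at (R : realType) (nu : probability R R) (w s : R) : Prop :=
  exists x : R, x < 0 /\ eta nu x = w /\ s = x / w.

(* Main.v *)
(* Write psi + 1 = int 1/(1 - z s) and eta = 1 - 1/(1 + psi). On the negative axis
   the hypothesis says eta_mut (z) = eta_mu (omega (z)) with
   omega (z) = z^(1/t) eta_mut (z)^(1 - 1/t), and this formula makes sense on the
   whole upper half-plane since eta_mut avoids [0, +oo[ there, so the identity
   propagates by analytic continuation. If mut charges a and b but not ]a, b[, then
   1 + psi_mut is real and continuous on ]1/b, 1/a[ and runs from -oo to a positive
   value, so it takes a value in ]0, 1[ at some x, where eta_mut (x) < 0.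
   There omega (x) has argument pi (1 - 1/t), hence lies in the open upper
   half-plane, which eta_mu maps to itself: eta_mu (omega (x)) cannot be the real
   number eta_mut (x).
   Analytic continuation is obtained from the maximum principle alone: after
   passing to log z, a function vanishing on one side of a rectangle is compared
   with exponentials of large multiples of a harmonic function which is positive
   inside and zero on the other three sides. *)
Require Import Defs.
From HB Require Import structures.
From mathcomp Require Import all_boot all_order all_algebra.
From mathcomp Require Import all_classical all_reals all_analysis.
From mathcomp Require Import measurable_realfun.
From mathcomp Require Import ring lra.
From mathcomp Require Import complex.
Import Order.TTheory GRing.Theory Num.Theory.
Import numFieldTopology.Exports numFieldNormedType.Exports.
Local Open Scope classical_set_scope.
Local Open Scope complex_scope.
Local Open Scope ring_scope.
Set Implicit Arguments. Unset Strict Implicit. Unset Printing Implicit Defensive.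

(** * The complex modulus as a real number *)

Definition cabs (R : realType) (z : R[i]) : R := Normc.normc z.
Arguments cabs : simpl never.
Local Notation N := (@cabs _).

Section ComplexNorm.
Variable R : realType.
Implicit Types z w : R[i].

Lemma cabs_ge0 z : 0 <= N z.
Proof. by case: z => a b; exact: sqrtr_ge0. Qed.

Lemma cabsM z w : N (z * w) = N z * N w.
Proof. exact: Normc.normcM. Qed.

Lemma cabsV z : N z^-1 = (N z)^-1.
Proof. exact: Normc.normcV. Qed.

Lemma cabs1 : N (1 : R[i]) = 1. Proof. exact: Normc.normc1. Qed.


Lemma cabs_sqr z : N z ^+ 2 = complex.Re z ^+ 2 + complex.Im z ^+ 2.
Proof. by case: z => a b; rewrite /cabs /=; rewrite sqr_sqrtr// addr_ge0 ?sqr_ge0. Qed.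

Lemma cabs_gt0 z : (0 < N z) = (z != 0).
Proof.
rewrite lt_def cabs_ge0 andbT; congr negb; apply/eqP/eqP => [/Normc.eq0_normc//|->].
exact: Normc.normc0.
Qed.

Lemma cabsN z : N (- z) = N z. Proof. exact: normcN. Qed.

Lemma cabs_tri z w : N (z + w) <= N z + N w. Proof. exact: le_normcD. Qed.

Lemma cabs_triB z w : N (z - w) <= N z + N w.
Proof. by apply: le_trans (cabs_tri _ _) _; rewrite cabsN. Qed.

Lemma cabs_dist z w : `|N z - N w| <= N (z - w).
Proof.
have h1 := cabs_tri (z - w) w; have h2 := cabs_triB z (z - w).
rewrite subrK in h1; rewrite subKr in h2.
by rewrite ler_norml; apply/andP; split; lra.
Qed.

Lemma cabsX z n : N (z ^+ n) = N z ^+ n.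
Proof.
by elim: n => [|n IH]; rewrite ?expr0 ?cabs1// !exprS cabsM IH.
Qed.

Lemma cabs_Re z : `|complex.Re z| <= N z.
Proof.
by case: z => a b; rewrite /cabs /=; rewrite -sqrtr_sqr ler_wsqrtr// lerDl sqr_ge0.
Qed.

Lemma cabs_Im z : `|complex.Im z| <= N z.
Proof.
by case: z => a b; rewrite /cabs /=; rewrite -sqrtr_sqr ler_wsqrtr// lerDr sqr_ge0.
Qed.

Lemma cabs_real (a : R) : N (a%:C) = `|a|.
Proof. by rewrite /cabs /= expr0n addr0 sqrtr_sqr. Qed.

Lemma cabs_le_ReIm z : N z <= `|complex.Re z| + `|complex.Im z|.
Proof.
rewrite -(ler_pXn2r (n := 2)) ?nnegrE ?cabs_ge0 ?addr_ge0// cabs_sqr.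
rewrite -[X in X + _ <= _]real_normK ?num_real// -[X in _ + X <= _]real_normK ?num_real//.
by have := mulr_ge0 (normr_ge0 (complex.Re z)) (normr_ge0 (complex.Im z)); nra.
Qed.

End ComplexNorm.

(** * Landau orders at the origin of the complex plane *)

Section LandauAtZero.
Variable R : realType.
Implicit Types f g : R[i] -> R[i].

Definition bigO0 (k : nat) f := exists M r : R,
  [/\ 0 <= M, 0 < r & forall h, N h < r -> N (f h) <= M * N h ^+ k].

Lemma bigO0_ext k f g : f =1 g -> bigO0 k f -> bigO0 k g.
Proof. by move=> fg [M [r [M0 r0 H]]]; exists M, r; split=> // h /H; rewrite fg. Qed.

Lemma bigO0D k f g : bigO0 k f -> bigO0 k g -> bigO0 k (fun h => f h + g h).
Proof.
move=> [M [r [M0 r0 H]]] [M' [r' [M0' r0' H']]].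
exists (M + M'), (Num.min r r'); split=> [||h]; rewrite ?addr_ge0 ?lt_min ?r0//.
move=> /andP[/H h1 /H' h2] /=; apply: le_trans (cabs_tri _ _) _.
by rewrite mulrDl lerD.
Qed.

Lemma bigO0M k l f g : bigO0 k f -> bigO0 l g -> bigO0 (k + l) (fun h => f h * g h).
Proof.
move=> [M [r [M0 r0 H]]] [M' [r' [M0' r0' H']]].
exists (M * M'), (Num.min r r'); split=> [||h]; rewrite ?mulr_ge0 ?lt_min ?r0//.
move=> /andP[/H h1 /H' h2] /=; rewrite cabsM exprD mulrACA.
by apply: ler_pM; rewrite ?cabs_ge0.
Qed.

Lemma bigO0_cst (c : R[i]) : bigO0 0 (fun=> c).
Proof. by exists (N c), 1; split; rewrite ?cabs_ge0// => h _; rewrite expr0 mulr1. Qed.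

Lemma bigO0_id : bigO0 1 (@id R[i]).
Proof. by exists 1, 1; split=> // h _; rewrite expr1 mul1r. Qed.

Lemma bigO0Z k c f : bigO0 k f -> bigO0 k (fun h => c * f h).
Proof. exact: (bigO0M (bigO0_cst c)). Qed.

Lemma bigO0X k : bigO0 k (fun h : R[i] => h ^+ k).
Proof. by exists 1, 1; split=> // h _; rewrite cabsX mul1r. Qed.

Lemma bigO0_le k l f : (l <= k)%N -> bigO0 k f -> bigO0 l f.
Proof.
move=> lk [M [r [M0 r0 H]]]; exists M, (Num.min r 1); split=> // [|h].
  by rewrite lt_min r0 /=.
rewrite lt_min => /andP[/H h1 /ltW h2]; apply: le_trans h1 _.
by rewrite ler_wpM2l// ler_wiXn2l ?cabs_ge0.
Qed.

Lemma bigO0_small f (e : R) : 0 < e -> bigO0 1 f ->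
  exists2 r, 0 < r & forall h, N h < r -> N (f h) < e.
Proof.
move=> e0 [M [r [M0 r0 H]]]; have M1 : 0 < M + 1 by lra.
exists (Num.min r (e / (M + 1))) => [|h]; first by rewrite lt_min r0 divr_gt0.
rewrite lt_min ltr_pdivlMr// => /andP[/H h1 h2].
rewrite expr1 in h1; have := cabs_ge0 h; nra.
Qed.

Lemma bigO0_comp k f g : bigO0 k f -> bigO0 1 g -> bigO0 k (f \o g).
Proof.
move=> [M [r [M0 r0 H]]] og; have [r1 r10 H1] := bigO0_small r0 og.
case: og => [M' [r' [M0' r0' H']]].
exists (M * M' ^+ k), (Num.min r1 r'); split=> [||h].
- by rewrite mulr_ge0// exprn_ge0.
- by rewrite lt_min r10.
rewrite lt_min /= => /andP[/H1/H h1 /H' h2]; apply: le_trans h1 _.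
rewrite -mulrA ler_wpM2l// -exprMn lerXn2r ?nnegrE ?cabs_ge0 ?mulr_ge0 ?cabs_ge0//.
Qed.

End LandauAtZero.

(** * Second-order expansions and their stability under algebraic operations *)

Section Taylor2.
Variable R : realType.
Implicit Types (f g : R[i] -> R[i]) (z : R[i]).

(* Quadratic Taylor expansion with cubic remainder: all the regularity that the
   maximum principle below uses, and closed under composition by plain algebra. *)
Definition taylor2 f z := exists a1 a2 : R[i],
  bigO0 3 (fun h => f (z + h) - f z - a1 * h - a2 * h ^+ 2).

Lemma taylor2_bigO1 f z : taylor2 f z -> bigO0 1 (fun h => f (z + h) - f z).
Proof.
move=> [a1 [a2 o3]].
have o1 := bigO0_le (isT : (1 <= 3)%N) o3.
have o2 := bigO0D (bigO0Z a1 (@bigO0_id R)) (bigO0_le (isT : (1 <= 2)%N) (bigO0Z a2 (@bigO0X R 2))).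
by apply: bigO0_ext (bigO0D o1 o2) => h /=; ring.
Qed.

Lemma taylor2_continuous f z (e : R) : taylor2 f z -> 0 < e ->
  exists2 r, 0 < r & forall h, N h < r -> N (f (z + h) - f z) < e.
Proof. by move=> /taylor2_bigO1 o1 e0; exact: (bigO0_small e0 o1). Qed.

Lemma taylor2_cst c z : taylor2 (fun=> c) z.
Proof.
exists 0, 0; apply: bigO0_ext (bigO0_le (isT : (3 <= 3)%N) (bigO0Z 0 (@bigO0X R 3))).
by move=> h; ring.
Qed.

Lemma taylor2_id z : taylor2 id z.
Proof.
exists 1, 0; apply: bigO0_ext (bigO0_le (isT : (3 <= 3)%N) (bigO0Z 0 (@bigO0X R 3))).
by move=> h; ring.
Qed.

Lemma taylor2D f g z : taylor2 f z -> taylor2 g z -> taylor2 (fun x => f x + g x) z.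
Proof.
move=> [a1 [a2 o1]] [b1 [b2 o2]]; exists (a1 + b1), (a2 + b2).
by apply: bigO0_ext (bigO0D o1 o2) => h; ring.
Qed.

(** For the increment [k] of [g], [k h - a1 * h] is of order two, so the factorization of
    [k h ^+ 2 - a1 ^+ 2 * h ^+ 2] as difference times sum makes it of order three. *)
Lemma taylor2_comp f g z : taylor2 g z -> taylor2 f (g z) -> taylor2 (f \o g) z.
Proof.
move=> tg; have k1 := taylor2_bigO1 tg.
case: tg => a1 [a2 oa] [b1 [b2 ob]].
exists (b1 * a1), (b1 * a2 + b2 * a1 ^+ 2).
pose k h := g (z + h) - g z.
have oc := bigO0_comp ob k1.
have o2 : bigO0 2 (fun h => k h - a1 * h).
  apply: bigO0_ext (bigO0D (bigO0_le (isT : (2 <= 3)%N) oa) (bigO0Z a2 (@bigO0X R 2))).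
  by move=> h; rewrite /k /=; ring.
have od := bigO0Z b2 (bigO0M o2 (bigO0D k1 (bigO0Z a1 (@bigO0_id R)))).
apply: bigO0_ext (bigO0D oc (bigO0D od (bigO0Z b1 oa))).
by move=> h; rewrite /k /= [g z + _]addrC subrK; ring.
Qed.

Lemma taylor2_sqr z : taylor2 (fun x => x ^+ 2) z.
Proof.
exists (2 * z), 1; apply: bigO0_ext (bigO0Z 0 (@bigO0X R 3)) => h; ring.
Qed.

Lemma taylor2Z c f z : taylor2 f z -> taylor2 (fun x => c * f x) z.
Proof.
move=> [a1 [a2 o1]]; exists (c * a1), (c * a2).
by apply: bigO0_ext (bigO0Z c o1) => h; ring.
Qed.

Lemma taylor2N f z : taylor2 f z -> taylor2 (fun x => - f x) z.
Proof. by move=> /(taylor2Z (-1)); under eq_fun do rewrite mulN1r. Qed.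

Lemma taylor2B f g z : taylor2 f z -> taylor2 g z -> taylor2 (fun x => f x - g x) z.
Proof.
move=> tf tg; have := taylor2D tf (taylor2Z (-1) tg).
by under eq_fun do rewrite mulN1r.
Qed.

(** Polarization: a product is a quarter of the difference of the squares of sum and difference, so
    composition with squaring suffices. *)
Lemma taylor2M f g z : taylor2 f z -> taylor2 g z -> taylor2 (fun x => f x * g x) z.
Proof.
move=> tf tg.
have t1 := taylor2_comp (taylor2D tf tg) (taylor2_sqr _).
have t2 := taylor2_comp (taylor2B tf tg) (taylor2_sqr _).
have := taylor2Z (4^-1) (taylor2B t1 t2).
by congr (taylor2 _ _); apply/funext => x /=; field.
Qed.

(** The remainder is exactly [- h ^+ 3 / (z ^+ 3 * (z + h))], and [z + h] keeps at least half the
    modulus of [z] for the [h] considered. *)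
Lemma taylor2V z : z != 0 -> taylor2 (fun x => x^-1) z.
Proof.
move=> z0; exists (- z ^- 2), (z ^- 3).
have Nz : 0 < N z by rewrite cabs_gt0.
exists (2 * (N z ^+ 4)^-1), (N z / 2); split=> [||h].
- by rewrite mulr_ge0 ?invr_ge0 ?exprn_ge0 ?cabs_ge0.
- by rewrite divr_gt0.
move=> hz.
have Nzh : N z / 2 <= N (z + h).
  have := cabs_triB (z + h) h; rewrite addrK; lra.
have zh : z + h != 0 by rewrite -cabs_gt0; lra.
have -> : (z + h)^-1 - z^-1 - - z ^- 2 * h - z ^- 3 * h ^+ 2 =
  - h ^+ 3 * (z ^+ 3 * (z + h))^-1 by field; rewrite z0 zh.
rewrite cabsM cabsN cabsX cabsV cabsM cabsX mulrC.
apply: ler_wpM2r; first by rewrite exprn_ge0 ?cabs_ge0.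
rewrite -[2]invrK -invfM lef_pV2 ?posrE.
- by rewrite mulrC [N z ^+ 4]exprSr -mulrA ler_wpM2l// exprn_ge0 ?cabs_ge0.
- by rewrite mulr_gt0 ?exprn_gt0//; lra.
- by rewrite mulr_gt0 ?exprn_gt0.
Qed.

End Taylor2.

(** * The maximum modulus principle on a rectangle *)

Section MaximumPrinciple.
Variable R : realType.
Implicit Types (F : R[i] -> R[i]) (z w : R[i]).

(* Averaging over z0 + k, z0 + ik, z0 - k, z0 - ik kills the linear and quadratic
   terms of F, so that |F|^2 loses at most O(k^3) while |z|^2 gains k^2. *)
Lemma no_local_max F z0 (e rho : R) : 0 < e -> 0 < rho -> taylor2 F z0 ->
  exists2 k, N k < rho &
    N (F z0) ^+ 2 + e * N z0 ^+ 2 < N (F (z0 + k)) ^+ 2 + e * N (z0 + k) ^+ 2.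
Proof.
move=> e0 rho0 [a1 [a2 [M [r [M0 r0 H]]]]].
pose u := complex.Re (F z0); pose v := complex.Im (F z0).
pose A := `|u| + `|v|; have A0 : 0 <= A by rewrite addr_ge0.
have D0 : 0 < 2 * A * M + 1 by rewrite ltr_wpDl// !mulr_ge0.
(* Below this size the four remainders, together at most [8 * A * M * s ^+ 3], lose against the gain
   [4 * e * s ^+ 2]. *)
pose s := Num.min (Num.min r rho) (e / (2 * A * M + 1)) / 2.
have m0 : 0 < Num.min (Num.min r rho) (e / (2 * A * M + 1)).
  by rewrite !lt_min r0 rho0 divr_gt0.
have s0 : 0 < s by rewrite divr_gt0.
have : s < Num.min (Num.min r rho) (e / (2 * A * M + 1)) by rewrite /s; lra.
rewrite !lt_min => /andP[/andP[sr srho]]; rewrite ltr_pdivlMr// => se.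
pose G z := N (F z) ^+ 2 + e * N z ^+ 2.
pose K := [:: s%:C; s *i; (- s)%:C; (- s) *i].
have NK k : k \in K -> N k = s.
  rewrite !inE => /or4P[]/eqP->; rewrite /cabs /= expr0n ?addr0 ?add0r ?sqrrN sqrtr_sqr;
    by rewrite gtr0_norm.
apply: contrapT => noK.
have {noK} hG k : k \in K -> G (z0 + k) <= G z0.
  move=> kK; rewrite leNgt; apply/negP => lt; apply: noK; exists k => //.
  by rewrite NK.
pose E k := F (z0 + k) - F z0 - a1 * k - a2 * k ^+ 2.
(* [L w] is the real part of [w] times the conjugate of [F z0]; twice [L] of an increment of [F]
   bounds the increment of [|F|^2] from below, the missing term being a square. *)
pose L w := u * complex.Re w + v * complex.Im w.
have LE k : k \in K -> `|L (E k)| <= A * (M * s ^+ 3).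
  move=> kK; have := H k; rewrite NK// => /(_ sr) HE.
  have HR := le_trans (cabs_Re _) HE; have HI := le_trans (cabs_Im _) HE.
  rewrite /L; apply: le_trans (ler_normD _ _) _; rewrite !normrM mulrDl.
  by rewrite lerD// ler_wpM2l.
have GL k : k \in K ->
    2 * L (F (z0 + k) - F z0) + e * (N (z0 + k) ^+ 2 - N z0 ^+ 2) <= 0.
  move=> kK; have := hG k kK; rewrite /G !cabs_sqr.
  rewrite /L /u /v; case: (F (z0 + k)) => p q; case: (F z0) => p' q' /=.
  move=> h; have := sqr_ge0 (p - p'); have := sqr_ge0 (q - q'); nra.
have sumL : L (F (z0 + s%:C) - F z0) + L (F (z0 + s *i) - F z0)
  + L (F (z0 + (- s)%:C) - F z0) + L (F (z0 + (- s) *i) - F z0)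
  = L (E s%:C) + L (E (s *i)) + L (E (- s)%:C) + L (E ((- s) *i)).
  rewrite /L /E !expr2.
  case: (F (z0 + s%:C)) (F (z0 + s *i)) (F (z0 + (- s)%:C)) (F (z0 + (- s) *i)) (F z0) (a1) (a2)
    => [p q] [p1 q1] [p2 q2] [p3 q3] [p4 q4] [p5 q5] [p6 q6] /=.
  ring.
have sumN : N (z0 + s%:C) ^+ 2 + N (z0 + s *i) ^+ 2 + N (z0 + (- s)%:C) ^+ 2
  + N (z0 + (- s) *i) ^+ 2 = 4 * N z0 ^+ 2 + 4 * s ^+ 2.
  rewrite !cabs_sqr; case: (z0) => a b /=; ring.
have [k1 k2 k3 k4] : [/\ s%:C \in K, s *i \in K, (- s)%:C \in K & (- s) *i \in K].
  by rewrite !inE !eqxx !orbT.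
have := GL _ k1; have := GL _ k2; have := GL _ k3; have := GL _ k4.
have := LE _ k1; have := LE _ k2; have := LE _ k3; have := LE _ k4.
rewrite !ler_norml => /andP[l4 _] /andP[l3 _] /andP[l2 _] /andP[l1 _] g4 g3 g2 g1.
have tot : 2 * (- (4 * (A * (M * s ^+ 3)))) + e * (4 * s ^+ 2) <= 0.
  have : 0 <= L (E s%:C) + L (E (s *i)) + L (E (- s)%:C) + L (E ((- s) *i)) + 4 * (A * (M * s ^+ 3)) by lra.
  rewrite -sumL => h.
  have -> : e * (4 * s ^+ 2) = e * (N (z0 + s%:C) ^+ 2 - N z0 ^+ 2)
   + e * (N (z0 + s *i) ^+ 2 - N z0 ^+ 2) + e * (N (z0 + (- s)%:C) ^+ 2 - N z0 ^+ 2)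
   + e * (N (z0 + (- s) *i) ^+ 2 - N z0 ^+ 2).
    by rewrite -!mulrDr; congr (e * _); lra.
  lra.
have : 0 < 4 * s ^+ 2 * (e - s * (2 * A * M)).
  by rewrite !mulr_gt0 ?exprn_gt0//; lra.
have -> : 4 * s ^+ 2 * (e - s * (2 * A * M)) = 2 * (- (4 * (A * (M * s ^+ 3)))) + e * (4 * s ^+ 2) by ring.
lra.
Qed.

Definition rect (r h : R) z :=
  - r <= complex.Re z <= r /\ 0 <= complex.Im z <= h.

(** Points are pairs of reals here so that compactness of a product of two segments can be used. *)
Lemma continuous_cabs F (p : R * R) : taylor2 F (p.1 +i* p.2) ->
  {for p, continuous (fun q : R * R => N (F (q.1 +i* q.2)))}.
Proof.
move=> tF; apply/cvgrPdist_lt => e e0 /=.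
have [r r0 H] := taylor2_continuous tF e0.
have r2 : 0 < r / 2 by rewrite divr_gt0.
apply/(@nbhs_ballP R (R * R)%type); exists (r / 2) => // q [/= q1 q2].
have := H (- (p.1 - q.1) +i* - (p.2 - q.2)); move=> HH.
have -> : q.1 +i* q.2 = p.1 +i* p.2 + (- (p.1 - q.1) +i* - (p.2 - q.2)).
  by apply/eqP; rewrite eq_complex /=; apply/andP; split; apply/eqP; ring.
move: HH; set k := (- (p.1 - q.1) +i* _) => HH.
have {}q1 : `|p.1 - q.1| < r / 2 := q1.
have {}q2 : `|p.2 - q.2| < r / 2 := q2.
have Nk : N k < r.
  by apply: le_lt_trans (cabs_le_ReIm _) _; rewrite /= !normrN; lra.
apply: le_lt_trans (HH Nk); rewrite distrC.
exact: cabs_dist.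
Qed.



Lemma rect_max (G : R * R -> R) (r h : R) : 0 < r -> 0 < h ->
  (forall p, rect r h (p.1 +i* p.2) -> {for p, continuous G}) ->
  exists2 c, rect r h (c.1 +i* c.2) &
    forall p, rect r h (p.1 +i* p.2) -> G p <= G c.
Proof.
move=> r0 h0 cG.
have rectE p : (p \in `[(- r), r] `*` `[0, h]) <-> rect r h (p.1 +i* p.2).
  by rewrite inE /rect /=; split=> -[]; rewrite !in_itv.
have [|||c /rectE cA cM] := @compact_EVT_max _ R G (`[(- r), r] `*` `[0, h]).
- by exists (0, 0); split; rewrite /= in_itv /=; apply/andP; split; lra.
- by apply: compact_setX; exact: segment_compact.
- by apply: continuous_in_subspaceT => p /rectE; exact: cG.
- by exists c => // p /rectE; exact: cM.
Qed.

(** If [|F z1| > m], add [e * |z|^2] with [e] so small that it cannot make up for the excess [d] of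
    [|F z1|^2] over [m ^+ 2]: the perturbed function has its maximum off the sides, which
    [no_local_max] forbids. *)
Lemma max_modulus F (r h m : R) : 0 < r -> 0 < h -> 0 <= m ->
  (forall z, rect r h z -> taylor2 F z) ->
  (forall z, rect r h z -> [\/ complex.Re z = - r, complex.Re z = r,
     complex.Im z = 0 | complex.Im z = h] -> N (F z) <= m) ->
  forall z, rect r h z -> N (F z) <= m.
Proof.
move=> r0 h0 m0 tF bF z1 z1R; rewrite leNgt; apply/negP => lt1.
pose d := N (F z1) ^+ 2 - m ^+ 2.
have d0 : 0 < d by rewrite /d; nra.
pose D := r ^+ 2 + h ^+ 2.
have D0 : 0 <= D by rewrite addr_ge0 ?sqr_ge0.
have DN z : rect r h z -> N z ^+ 2 <= D.
  by case=> /andP[? ?] /andP[? ?]; rewrite cabs_sqr /D; nra.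
pose e := d / (D + 1).
have D1 : 0 < D + 1 by lra.
have e0 : 0 < e by rewrite divr_gt0.
have eD : e * D < d.
  have <- : e * (D + 1) = d by rewrite /e divfK ?gt_eqF.
  by rewrite [e * (D + 1)]mulrDr mulr1 ltrDl.
clearbody e.
pose G (p : R * R) := N (F (p.1 +i* p.2)) ^+ 2 + e * N (p.1 +i* p.2) ^+ 2.
have [p pR|c cR cM] := rect_max (G := G) r0 h0.
  have c1 := continuous_cabs (tF _ pR).
  have c2 : {for p, continuous (fun q : R * R => N (q.1 +i* q.2))}.
    exact: continuous_cabs (taylor2_id _).
  rewrite /continuous_at /G; apply: cvgD.
    by under eq_fun do rewrite expr2; rewrite expr2; exact: cvgM.
  apply: cvgM; first exact: cvg_cst.
  by under eq_fun do rewrite expr2; rewrite expr2; exact: cvgM.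
have Gc : m ^+ 2 + d <= G c.
  have := cM (complex.Re z1, complex.Im z1); rewrite /G /=.
  have -> : complex.Re z1 +i* complex.Im z1 = z1 by case: (z1).
  move=> /(_ z1R); apply: le_trans; rewrite /d.
  have : 0 <= e * N z1 ^+ 2 by rewrite mulr_ge0 ?sqr_ge0 ?ltW.
  lra.
have eDN : e * N (c.1 +i* c.2) ^+ 2 <= e * D by rewrite ler_wpM2l ?DN ?ltW.
have inner : ~ [\/ c.1 = - r, c.1 = r, c.2 = 0 | c.2 = h].
  move=> /(bF _ cR) => b; have : N (F (c.1 +i* c.2)) ^+ 2 <= m ^+ 2.
    by rewrite lerXn2r ?nnegrE ?cabs_ge0.
  by move: Gc; rewrite /G; lra.
case: (cR) => /= /andP[cr1 cr2] /andP[ch1 ch2].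
have lt_of (x y : R) : x <= y -> x <> y -> x < y.
  by move=> xy nxy; rewrite lt_neqAle xy andbT; apply/eqP.
have {}cr1 : - r < c.1 by apply: lt_of => // /esym ?; apply: inner; constructor 1.
have {}cr2 : c.1 < r by apply: lt_of => // ?; apply: inner; constructor 2.
have {}ch1 : 0 < c.2 by apply: lt_of => // /esym ?; apply: inner; constructor 3.
have {}ch2 : c.2 < h by apply: lt_of => // ?; apply: inner; constructor 4.
pose rho := Num.min (Num.min (c.1 + r) (r - c.1)) (Num.min c.2 (h - c.2)).
have rho0 : 0 < rho by rewrite !lt_min ch1 !subr_gt0 cr2 ch2 !andbT; lra.
have [k Nk ltk] := no_local_max e0 rho0 (tF _ cR).
have kR : rect r h ((c.1 + complex.Re k) +i* (c.2 + complex.Im k)).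
  move: Nk; rewrite !lt_min => /andP[/andP[k1 k2] /andP[k3 k4]].
  have := cabs_Re k; have := cabs_Im k; rewrite !ler_norml => /andP[? ?] /andP[? ?].
  by split=> /=; apply/andP; split; lra.
have := cM (c.1 + complex.Re k, c.2 + complex.Im k) kR.
rewrite /G /= leNgt => /negP; apply.
by have -> : ((c.1 + complex.Re k) +i* (c.2 + complex.Im k)) = c.1 +i* c.2 + k by case: (k).
Qed.

End MaximumPrinciple.

(** * The complex exponential and its expansion *)

Section ComplexExponential.
Variable R : realType.
Implicit Types z w : R[i].

(** The mean value theorem gives [f x = df c * x] with [c] between [0] and [x], so one more power of
    [|x|] is gained; applied repeatedly to successive derivatives it gives the Taylor bounds. *)
Lemma MVT_growth (f df : R -> R) (C : R) (n : nat) :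
  (forall x : R, is_derive x 1 f (df x)) -> f 0 = 0 ->
  (forall x, `|x| <= 1 -> `|df x| <= C * `|x| ^+ n) ->
  forall x, `|x| <= 1 -> `|f x| <= C * `|x| ^+ n.+1.
Proof.
move=> fdf f0 dfC x x1.
have cf a b : {within `[a, b], continuous f}.
  apply: derivable_within_continuous => y _.
  by case: (fdf y).
have main c : `|c| <= `|x| -> f x = df c * x -> `|f x| <= C * `|x| ^+ n.+1.
  move=> cx ->; rewrite normrM exprSr mulrA ler_wpM2r//.
  have C0 : 0 <= C * `|c| ^+ n.
    by apply: le_trans (dfC c _); rewrite ?(le_trans cx).
  apply: le_trans (dfC c _) _; first exact: le_trans x1.
  (* Replacing [|c|] by [|x|] requires [0 <= C]: this sign is read from the bound at [c] if [c] is
     nonzero and from the bound at [1] if [c = 0] and [n > 0]; for [n = 0] both powers are [1]. *)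
  have [c0|c0] := eqVneq c 0; last first.
    rewrite ler_wpM2l ?lerXn2r ?nnegrE//.
    by move: C0; rewrite pmulr_lge0// exprn_gt0// normr_gt0.
  have [->|n0] := posnP n; first by rewrite !expr0.
  have C00 : 0 <= C by have := dfC 1; rewrite normr1 expr1n mulr1 => /(_ (lexx _)); apply: le_trans.
  by rewrite ler_wpM2l ?lerXn2r ?nnegrE//.
have [x0|x0] := leP 0 x.
  have [c + E] := MVT_segment x0 (fun y _ => fdf y) (cf 0 x).
  rewrite in_itv /= => /andP[c0 cx]; apply: (main c).
    by rewrite !ger0_norm.
  by move: E; rewrite f0 !subr0.
have [c + E] := MVT_segment (ltW x0) (fun y _ => fdf y) (cf x 0).
rewrite in_itv /= => /andP[xc c0]; apply: (main c).
  by rewrite !ler0_norm ?lerN2 ?(ltW x0).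
move: E; rewrite f0; lra.
Qed.

Lemma expR_taylor (x : R) : `|x| <= 1 ->
  `|expR x - 1 - x - x ^+ 2 / 2| <= expR 1 * `|x| ^+ 3.
Proof.
apply: (MVT_growth (f := fun x => expR x - 1 - x - x ^+ 2 / 2)
  (df := fun x => expR x - 1 - x)) => [y||].
- by apply: is_derive_eq; rewrite /GRing.scale /=; field.
- by rewrite expR0; ring.
apply: (MVT_growth (f := fun x => expR x - 1 - x) (df := fun x => expR x - 1)) => [y||].
- by apply: is_derive_eq; ring.
- by rewrite expR0; ring.
apply: (MVT_growth (f := fun x => expR x - 1) (df := fun x => expR x)) => [y||y].
- by apply: is_derive_eq; ring.
- by rewrite expR0; ring.
rewrite ler_norml expr0 mulr1 => /andP[_ y1].
by rewrite ger0_norm ?expR_ge0// ler_expR.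
Qed.

Lemma cos_taylor1 (x : R) : `|x| <= 1 -> `|cos x - 1| <= 1 * `|x| ^+ 1.
Proof.
apply: (MVT_growth (f := fun x => cos x - 1) (df := fun x => - sin x)) => [y||y _].
- by apply: is_derive_eq; ring.
- by rewrite cos0; ring.
by rewrite normrN expr0 mulr1 ler_norml sin_geN1 sin_le1.
Qed.

Lemma sin_taylor (x : R) : `|x| <= 1 -> `|sin x - x| <= 1 * `|x| ^+ 3.
Proof.
apply: (MVT_growth (f := fun x => sin x - x) (df := fun x => cos x - 1)) => [|].
- by rewrite sin0; ring.
apply: (MVT_growth (f := fun x => cos x - 1) (df := fun x => - sin x)) => [y||].
- by apply: is_derive_eq; ring.
- by rewrite cos0; ring.
apply: (MVT_growth (f := fun x => - sin x) (df := fun x => - cos x)) => [|y _].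
- by rewrite sin0; ring.
by rewrite normrN expr0 mulr1 ler_norml cos_geN1 cos_le1.
Qed.

Lemma cos_taylor (x : R) : `|x| <= 1 -> `|cos x - 1 + x ^+ 2 / 2| <= 1 * `|x| ^+ 3.
Proof.
apply: (MVT_growth (f := fun x => cos x - 1 + x ^+ 2 / 2) (df := fun x => - sin x + x)) => [y||].
- by apply: is_derive_eq; rewrite /GRing.scale /=; field.
- by rewrite cos0; ring.
apply: (MVT_growth (f := fun x => - sin x + x) (df := fun x => - (cos x - 1))) => [y||].
- by apply: is_derive_eq; ring.
- by rewrite sin0; ring.
by move=> y y1; rewrite normrN; exact: cos_taylor1.
Qed.

Definition cexp z : R[i] :=
  (expR (complex.Re z))%:C * (cos (complex.Im z) +i* sin (complex.Im z)).

Lemma cexpD z w : cexp (z + w) = cexp z * cexp w.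
Proof.
rewrite /cexp; case: z w => [a b] [c d] /=; rewrite expRD cosD sinD.
by apply/eqP; rewrite eq_complex /=; apply/andP; split; apply/eqP; ring.
Qed.

Lemma cexpE (z : R[i]) :
  cexp z = expR (complex.Re z) * cos (complex.Im z) +i* (expR (complex.Re z) * sin (complex.Im z)).
Proof. by apply/eqP; rewrite eq_complex /=; apply/andP; split; apply/eqP; ring. Qed.

Lemma cabs_cexp z : N (cexp z) = expR (complex.Re z).
Proof.
rewrite /cexp cabsM cabs_real ger0_norm ?expR_ge0//.
rewrite /cabs /= cos2Dsin2 sqrtr1 mulr1//.
Qed.

(** Here [p] will be the real or the imaginary part, which turns the real Taylor bounds into complex
    ones. *)
Lemma bigO0_of_real (f : R -> R) (p : R[i] -> R) (C : R) k :
  0 <= C -> (forall x, `|x| <= 1 -> `|f x| <= C * `|x| ^+ k) ->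
  (forall h, `|p h| <= N h) -> bigO0 k (fun h => (f (p h))%:C).
Proof.
move=> C0 fC pN; exists C, 1; split=> // h h1; rewrite cabs_real.
apply: le_trans (fC _ _) _; first by rewrite (le_trans (pN h)) ?ltW.
by rewrite ler_wpM2l// lerXn2r ?nnegrE ?cabs_ge0.
Qed.

(** Multiply the real expansions of [exp X] and of [cos Y + i sin Y], where [h = X + i Y]: apart
    from their remainders only [X Y^2], [X^2 Y] and [X^2 Y^2] survive, all of order at least
    three. *)
Lemma cexp_taylor0 : bigO0 3 (fun h : R[i] => cexp h - 1 - h - h ^+ 2 / 2).
Proof.
have oE := bigO0_of_real (expR_ge0 1) expR_taylor (@cabs_Re R).
have oC := bigO0_of_real ler01 cos_taylor (@cabs_Im R).
have oS := bigO0_of_real ler01 sin_taylor (@cabs_Im R).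
have oid (x : R) : `|x| <= 1 -> `|x| <= 1 * `|x| ^+ 1 by rewrite mul1r expr1.
have oX := bigO0_of_real ler01 oid (@cabs_Re R).
have oY := bigO0_of_real ler01 oid (@cabs_Im R).
have oU : bigO0 0 (fun h : R[i] => cos (complex.Im h) +i* sin (complex.Im h)).
  by exists 1, 1; split=> // h _; rewrite expr0 mulr1 /cabs /= cos2Dsin2 sqrtr1.
have o1 := bigO0M oE oU.
have X2 := bigO0_le (isT : (1 <= 1 + 1)%N) (bigO0M oX oX).
have P0 := bigO0_le (isT : (0 <= 1)%N) (bigO0D oX (bigO0Z (2^-1) X2)).
have o2 := bigO0M (bigO0D (bigO0_cst 1) P0) (bigO0D oC (bigO0Z 'i oS)).
have XY2 := bigO0M oX (bigO0M oY oY).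
have X2Y := bigO0M oX (bigO0M oX oY).
have X2Y2 := bigO0_le (isT : (3 <= 4)%N) (bigO0M oX XY2).
apply: bigO0_ext (bigO0D (bigO0D o1 o2) (bigO0D (bigO0Z (- 2^-1) XY2)
  (bigO0D (bigO0Z (- 4^-1) X2Y2) (bigO0Z ('i * 2^-1) X2Y)))) => h.
rewrite /cexp.
have hE : h = (complex.Re h)%:C + 'i * (complex.Im h)%:C by exact: complexE.
rewrite [X in _ = _ - X - _]hE [X in _ = _ - _ - X ^+ 2 / 2]hE.
have -> : cos (complex.Im h) +i* sin (complex.Im h) =
  (cos (complex.Im h))%:C + 'i * (sin (complex.Im h))%:C.
  exact: complexE.
rewrite !(rmorphB, rmorphD, rmorphM, rmorph1, rmorphXn, fmorphV, rmorph_nat) /=.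
set X := (complex.Re h)%:C; set Y := (complex.Im h)%:C; set EX := (expR _)%:C.
set cY := (cos _)%:C; set sY := (sin _)%:C.
have i2 : ('i : R[i]) ^+ 2 = -1 by exact: sqr_i.
(* With the imaginary unit made an indeterminate, the two sides differ by a multiple of
   [I ^+ 2 + 1]. *)
move: ('i : R[i]) i2 => I i2.
apply/eqP; rewrite -subr_eq0; apply/eqP.
by transitivity (Y ^+ 2 / 2 * (I ^+ 2 + 1)); [field | rewrite i2 addNr mulr0].
Qed.

Lemma taylor2_cexp z : taylor2 cexp z.
Proof.
exists (cexp z), (cexp z / 2).
apply: bigO0_ext (bigO0Z (cexp z) cexp_taylor0) => h.
by rewrite cexpD; field.
Qed.

End ComplexExponential.

(** * Unique continuation from a boundary segment *)

Section UniqueContinuation.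
Variable R : realType.
Implicit Types (F : R[i] -> R[i]) (z : R[i]).

(* With k = pi / 2r the harmonic function Re (2 sinh (k (h + i z))) =
   2 sinh (k (h - y)) cos (k x) is positive inside the rectangle and zero on the
   three sides other than y = 0; multiplying F by exp of its large multiples
   leaves |F| unchanged on these sides. *)
Lemma vanish_from_side F (r h : R) : 0 < r -> 0 < h ->
  (forall z, rect r h z -> taylor2 F z) ->
  (forall x, - r <= x <= r -> F x%:C = 0) ->
  forall z, - r < complex.Re z < r -> 0 <= complex.Im z < h -> F z = 0.
Proof.
move=> r0 h0 tF F0 z /andP[zr1 zr2] /andP[zi1 zi2].
have zR : rect r h z by split; apply/andP; split; lra.
have [c cR cM] : exists2 c : R * R, rect r h (c.1 +i* c.2) &
    forall p : R * R, rect r h (p.1 +i* p.2) -> N (F (p.1 +i* p.2)) <= N (F (c.1 +i* c.2)).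
  by apply: rect_max => // p pR; apply: continuous_cabs; exact: tF.
set M := N _ in cM.
have {cM} FM w : rect r h w -> N (F w) <= M.
  by case: w => x y; exact: (cM (x, y)).
have M0 : 0 <= M by exact: cabs_ge0.
pose k := pi / (2 * r).
have k0 : 0 < k by rewrite divr_gt0 ?pi_gt0 ?mulr_gt0.
have kr : k * r = pi / 2 by rewrite /k; field; rewrite gt_eqF.
pose phi w := cexp (k%:C * (h%:C + 'i * w)) - cexp (- (k%:C * (h%:C + 'i * w))).
have Rephi w : complex.Re (phi w) = (expR (k * (h - complex.Im w))
    - expR (- (k * (h - complex.Im w)))) * cos (k * complex.Re w).
  rewrite /phi !cexpE; case: w => x y /=.
  rewrite !(mul0r, mul1r, subr0, addr0, add0r, sub0r, oppr0).
  by rewrite cosN mulrBl.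
have tphi w : taylor2 phi w.
  have t1 : taylor2 (fun w => k%:C * (h%:C + 'i * w)) w.
    apply: taylor2Z; apply: taylor2D; first exact: taylor2_cst.
    by apply: taylor2Z; exact: taylor2_id.
  apply: taylor2B.
    exact: (taylor2_comp t1 (taylor2_cexp _)).
  exact: (taylor2_comp (taylor2N t1) (taylor2_cexp _)).
have cosk : cos (k * r) = 0 by rewrite kr cos_pihalf.
have FE n : 0 <= n -> N (F z) * expR (n * complex.Re (phi z)) <= M.
  move=> n0; pose E w := F w * cexp (n%:C * phi w).
  have NE w : N (E w) = N (F w) * expR (n * complex.Re (phi w)).
    by rewrite /E cabsM cabs_cexp; case: (phi w) => x y /=; rewrite mul0r subr0.
  rewrite -NE; apply: (max_modulus r0 h0) => // w wR.
    apply: taylor2M; first exact: tF.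
    apply: (@taylor2_comp _ (@cexp R)); last exact: taylor2_cexp.
    by apply: taylor2Z; exact: tphi.
  move=> b; rewrite NE.
  have [w0|w0] := eqVneq (complex.Im w) 0.
    suff -> : F w = 0 by rewrite /cabs Normc.normc0 mul0r.
    have -> : w = (complex.Re w)%:C by move: w0; case: (w) => x y /= ->.
    by apply: F0; case: wR.
  suff -> : complex.Re (phi w) = 0 by rewrite mulr0 expR0 mulr1; exact: FM.
  rewrite Rephi; case: b => [->|->|/eqP|->].
  - by rewrite mulrN cosN cosk mulr0.
  - by rewrite cosk mulr0.
  - by rewrite (negbTE w0).
  - by rewrite subrr mulr0 oppr0 subrr mul0r.
have phi0 : 0 < complex.Re (phi z).
  rewrite Rephi mulr_gt0//.
    have : 0 < k * (h - complex.Im z) by rewrite mulr_gt0// subr_gt0.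
    by move=> kh; rewrite subr_gt0 ltr_expR; lra.
  have krE : k * complex.Re z < k * r by rewrite ltr_pM2l.
  have krE' : k * (- r) < k * complex.Re z by rewrite ltr_pM2l.
  apply: cos_gt0_pihalf; rewrite -kr; apply/andP; split; lra.
apply: contrapT => /eqP Fz0.
have NF0 : 0 < N (F z) by rewrite cabs_gt0.
(* For this multiple, [exp x >= 1 + x] raises the left side of [FE] to at least [N (F z) + M], which
   exceeds [M]. *)
have n0 : 0 <= M / (N (F z) * complex.Re (phi z)).
  by rewrite divr_ge0// ltW// mulr_gt0.
have := FE _ n0; apply/negP; rewrite -ltNge.
have := expR_ge1Dx (M / (N (F z) * complex.Re (phi z)) * complex.Re (phi z)).
rewrite -(ler_pM2l NF0); apply: lt_le_trans.
have -> : N (F z) * (1 + M / (N (F z) * complex.Re (phi z)) * complex.Re (phi z)) = N (F z) + M.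
  by field; rewrite !gt_eqF.
by rewrite ltrDr.
Qed.

Lemma taylor2_affine F (p q z : R[i]) : taylor2 F (p + q * z) ->
  taylor2 (fun w => F (p + q * w)) z.
Proof.
move=> tF; apply: (@taylor2_comp _ F (fun w => p + q * w)) => //.
apply: taylor2D; first exact: taylor2_cst.
by apply: taylor2Z; exact: taylor2_id.
Qed.

(** A rectangle hung from the segment on the line [Im = pi] gives vanishing on the vertical line
    through [u0]; rectangles based on that line and extending left or right then reach every point
    of the strip. *)
Lemma strip_vanish F (u0 rho : R) : 0 < rho ->
  (forall z, 0 < complex.Im z <= pi -> taylor2 F z) ->
  (forall u : R, u0 - rho <= u <= u0 + rho -> F (u +i* pi) = 0) ->
  forall z, 0 < complex.Im z < pi -> F z = 0.
Proof.
move=> rho0 tF F0.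
have vert (th : R) : 0 < th < pi -> F (u0 +i* th) = 0.
  move=> /andP[th0 thpi].
  have -> : u0 +i* th = (u0 +i* pi) + (-1) * (0 +i* (pi - th)).
    by apply/eqP; rewrite eq_complex /=; apply/andP; split; apply/eqP; ring.
  (* The half-turn puts the base on [Im = pi]; the height [pi - th / 2] goes beyond the point at
     level [th] but stops at level [th / 2], where [F] is still regular. *)
  apply: (@vanish_from_side (fun w => F ((u0 +i* pi) + (-1) * w)) rho (pi - th / 2)) => //=.
  - by lra.
  - move=> w [_ /andP[w1 w2]]; apply: taylor2_affine; apply: tF.
    by case: w w1 w2 => x y /= w1 w2; apply/andP; split; lra.
  - move=> x /andP[x1 x2].
    have -> : (u0 +i* pi) + (-1) * x%:C = (u0 - x) +i* pi.
      by apply/eqP; rewrite eq_complex /=; apply/andP; split; apply/eqP; ring.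
    by apply: F0; apply/andP; split; lra.
  - by apply/andP; split; lra.
  - by apply/andP; split; lra.
have side (s : R) (z : R[i]) : s ^+ 2 = 1 -> 0 <= s * (complex.Re z - u0) ->
    0 < complex.Im z < pi -> F z = 0.
  (* The sign [s] selects the side: multiplication by [- s * 'i] makes the real axis vertical and
     turns the upward direction into the horizontal direction of [s]. *)
  move=> s1 zs /andP[z1 z2].
  have -> : z = (u0 +i* (pi / 2)) + (0 +i* - s) * ((s * (pi / 2 - complex.Im z)) +i* (s * (complex.Re z - u0))).
    case: (z) => x y; apply/eqP; rewrite eq_complex /=; apply/andP; split; apply/eqP.
      transitivity (u0 + s ^+ 2 * (x - u0)); last by ring.
      by rewrite s1; ring.
    transitivity (pi / 2 - s ^+ 2 * (pi / 2 - y)); last by ring.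
    by rewrite s1; ring.
  have sP : s = 1 \/ s = -1.
    by move/eqP: s1; rewrite sqrf_eq1 => /orP[]/eqP->; [left|right].
  (* The half-width lies strictly between the distance of [z] to the middle line and [pi / 2], so
     the rectangle contains [z] off its long sides and stays within the open strip. *)
  pose r := (`|pi / 2 - complex.Im z| + pi / 2) / 2.
  have rlt : r < pi / 2.
    have : `|pi / 2 - complex.Im z| < pi / 2 by rewrite ltr_norml; apply/andP; split; lra.
    by rewrite /r; lra.
  have rgt : `|pi / 2 - complex.Im z| < r.
    by move: rlt; rewrite /r; lra.
  clearbody r.
  apply: (@vanish_from_side (fun w => F ((u0 +i* (pi / 2)) + (0 +i* - s) * w)) r (s * (complex.Re z - u0) + 1)) => //=.
  - by apply: le_lt_trans rgt.
  - by lra.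
  - move=> w [/andP[w1 w2] _]; apply: taylor2_affine; apply: tF.
    by case: w w1 w2 => x y /= w1 w2; case: sP => ->; apply/andP; split; lra.
  - move=> x /andP[x1 x2].
    have -> : (u0 +i* (pi / 2)) + (0 +i* - s) * x%:C = u0 +i* (pi / 2 - s * x).
      by apply/eqP; rewrite eq_complex /=; apply/andP; split; apply/eqP; ring.
    by apply: vert; case: sP => ->; apply/andP; split; lra.
  - by move: rgt; rewrite ltr_norml => /andP[? ?]; case: sP => ->; apply/andP; split; lra.
  - by apply/andP; split; lra.
move=> z zI; have [zu|zu] := leP u0 (complex.Re z).
  by apply: (side 1) => //; rewrite ?expr1n// mul1r subr_ge0.
by apply: (side (-1)) => //; [ring | lra].
Qed.

End UniqueContinuation.

(** * A logarithm on the plane cut along the nonnegative axis *)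

Section ComplexLogarithm.
Variable R : realType.
Implicit Types z w : R[i].

Lemma bigO0_near k (f g : R[i] -> R[i]) (r : R) : 0 < r ->
  (forall h, N h < r -> f h = g h) -> bigO0 k f -> bigO0 k g.
Proof.
move=> r0 fg [M [r' [M0 r'0 H]]]; exists M, (Num.min r r'); split=> // [|h].
  by rewrite lt_min r0.
by rewrite lt_min => /andP[/fg <-]; exact: H.
Qed.

(* The logarithm of C minus [0, +oo[ with argument in ]0, 2 pi[, by the half-angle
   formula for the argument; the domain is characterised by [Re w < |w|]. *)
Definition clog w : R[i] :=
  ln (N w) +i* (pi - 2 * atan (complex.Im w / (N w - complex.Re w))).

Lemma slit_ge0 w : complex.Re w < N w -> 0 < N w.
Proof.
move=> ww; rewrite cabs_gt0; apply: contraTneq ww => ->.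
by rewrite /cabs Normc.normc0 ltxx.
Qed.

Lemma slit_Im w : complex.Im w != 0 -> complex.Re w < N w.
Proof.
move=> w0; apply: le_lt_trans (ler_norm _) _.
rewrite -(ltr_pXn2r (n := 2)) ?nnegrE ?cabs_ge0// cabs_sqr real_normK ?num_real//.
by rewrite ltrDl exprn_even_gt0.
Qed.

Lemma slit_neg (x : R) : x < 0 -> complex.Re x%:C < N x%:C.
Proof. by move=> x0; rewrite cabs_real /= (lt_le_trans x0). Qed.

Lemma cexp_clog w : complex.Re w < N w -> cexp (clog w) = w.
Proof.
move=> ww; have w0 := slit_ge0 ww.
have rhoE := cabs_sqr w; have wE : w = complex.Re w +i* complex.Im w by case: (w).
rewrite cexpE /clog [RHS]wE /= {wE}.
move: (N w) (complex.Re w) (complex.Im w) w0 ww rhoE => rho x y rho0 xr rhoE.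
have D0 : 0 < rho - x by rewrite subr_gt0.
rewrite lnK ?posrE//.
set a := atan _.
(* The argument is [pi - 2 * a], so [cos a ^+ 2] and [tan a] determine its cosine and sine through
   the duplication formulas. *)
have ca : cos a ^+ 2 = (rho - x) / (2 * rho).
  rewrite /a cos_atan exprVn sqr_sqrtr ?addr_ge0 ?sqr_ge0//.
  have -> : 1 + (y / (rho - x)) ^+ 2 = (2 * rho) / (rho - x).
    transitivity ((rho ^+ 2 + (x ^+ 2 + y ^+ 2) - 2 * rho * x) / (rho - x) ^+ 2).
      by field; rewrite gt_eqF.
    by rewrite -rhoE; field; rewrite gt_eqF.
  by field; rewrite !gt_eqF// mulr_gt0.
have cn0 : cos a != 0.
  apply/eqP => c0; move: ca; rewrite c0 expr0n /= => /esym/eqP.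
  by rewrite mulf_eq0 invr_eq0 !gt_eqF// mulr_gt0.
have sa : sin a = y / (rho - x) * cos a.
  have : tan a = y / (rho - x) by rewrite /a atanK.
  by rewrite /tan => <-; field.
have -> : pi - 2 * a = pi - (a + a) by ring.
rewrite cosB sinB cospi sinpi !mul0r addr0 sub0r cosD sinD sa.
apply/eqP; rewrite eq_complex /=; apply/andP; split; apply/eqP.
  transitivity (rho * (1 - 2 * cos a ^+ 2) + rho * (cos a ^+ 2 * (1 + (y / (rho - x)) ^+ 2) - 1)).
    by ring.
  have -> : cos a ^+ 2 * (1 + (y / (rho - x)) ^+ 2) = 1.
    rewrite -[RHS](cos2Dsin2 a) sa; ring.
  by rewrite ca; field; rewrite gt_eqF.
transitivity (rho * (2 * (y / (rho - x)) * cos a ^+ 2)); first by ring.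
by rewrite ca; field; rewrite !gt_eqF.
Qed.

Lemma Im_clog w : 0 < complex.Im (clog w) < 2 * pi.
Proof.
rewrite /clog /=; set a := atan _.
have := atan_gtNpi2 (complex.Im w / (N w - complex.Re w)).
have := atan_ltpi2 (complex.Im w / (N w - complex.Re w)).
by rewrite -/a => a1 a2; apply/andP; split; lra.
Qed.

Lemma clog_neg (x : R) : x < 0 -> clog x%:C = ln (- x) +i* pi.
Proof.
by move=> x0; rewrite /clog cabs_real /= mul0r atan0 mulr0 subr0 ltr0_norm.
Qed.

Lemma slit_near w : complex.Re w < N w ->
  exists2 r, 0 < r & forall h, N h < r -> complex.Re (w + h) < N (w + h).
Proof.
move=> ww; exists ((N w - complex.Re w) / 2) => [|h hw]; first by rewrite divr_gt0// subr_gt0.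
have := cabs_triB (w + h) h; rewrite addrK => h1.
have := cabs_Re h; rewrite ler_norml => /andP[_ h2].
have -> : complex.Re (w + h) = complex.Re w + complex.Re h by case: (w) (h) => [? ?] [? ?].
lra.
Qed.

Lemma continuous_complex (G : R * R -> R) z (e : R) : 0 < e ->
  {for (complex.Re z, complex.Im z), continuous G} ->
  exists2 r, 0 < r & forall h, N h < r ->
    `|G (complex.Re (z + h), complex.Im (z + h)) - G (complex.Re z, complex.Im z)| < e.
Proof.
move=> e0 /cvgrPdist_lt /(_ _ e0) /(@nbhs_ballP R (R * R)%type)[r r0 H].
exists r => // h hr; rewrite distrC; apply: H.
case: z h hr => [x y] [x' y'] hr; have := cabs_Re (x' +i* y'); have := cabs_Im (x' +i* y').
by move=> /= i1 i2; split; rewrite /ball /= opprD addNKr normrN; apply: le_lt_trans hr.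
Qed.

Lemma clog_continuous w (e : R) : complex.Re w < N w -> 0 < e ->
  exists2 r, 0 < r & forall h, N h < r -> N (clog (w + h) - clog w) < e.
Proof.
move=> ww e0.
have wE : complex.Re w +i* complex.Im w = w by case: (w).
pose p := (complex.Re w, complex.Im w).
have cN : {for p, continuous (fun q : R * R => N (q.1 +i* q.2))}.
  exact: continuous_cabs (taylor2_id _).
have w0 := slit_ge0 ww.
have c1 : {for p, continuous (fun q : R * R => ln (N (q.1 +i* q.2)))}.
  apply: (continuous_comp cN); rewrite /= wE; exact: continuous_ln.
have c2 : {for p, continuous (fun q : R * R => atan (q.2 / (N (q.1 +i* q.2) - q.1)))}.
  apply: (@continuous_comp _ _ _ (fun q : R * R => q.2 / (N (q.1 +i* q.2) - q.1)) (@atan R));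
    last exact: continuous_atan.
  apply: cvgM; first exact: cvg_snd.
  apply: cvgV; first by rewrite /= wE gt_eqF// subr_gt0.
  by apply: cvgB => //; exact: cvg_fst.
have e4 : 0 < e / 4 by rewrite divr_gt0.
have [r1 r10 H1] := continuous_complex e4 c1.
have [r2 r20 H2] := continuous_complex e4 c2.
exists (Num.min r1 r2) => [|h]; first by rewrite lt_min r10.
rewrite lt_min => /andP[/H1 h1 /H2 h2].
have E z : complex.Re z +i* complex.Im z = z by case: z.
rewrite /= !E in h1 h2.
apply: le_lt_trans (cabs_le_ReIm _) _; rewrite /clog /=.
set a := atan _ in h2 *; set b := atan _ in h2 *.
have -> : pi - 2 * a - (pi - 2 * b) = - 2 * (a - b) by ring.
rewrite normrM normrN (ger0_norm (_ : 0 <= 2))//; lra.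
Qed.

(** The increment [L] of [clog] satisfies [cexp (L h) = 1 + h / w]; once [L] is known to be of order
    one, inverting the expansion of [cexp] gives [L = k - k^2 / 2] up to order three, with
    [k = h / w]. *)
Lemma taylor2_clog w : complex.Re w < N w -> taylor2 clog w.
Proof.
move=> ww; have w0 := slit_ge0 ww.
have wn0 : w != 0 by rewrite -cabs_gt0.
pose L h := clog (w + h) - clog w.
have [rs rs0 Hs] := slit_near ww.
have eL h : N h < rs -> cexp (L h) - 1 = w^-1 * h.
  move=> /Hs hs; have : cexp (L h) * w = w + h.
    by rewrite -{1}(cexp_clog ww) -cexpD subrK cexp_clog.
  move=> E; apply: (mulIf wn0); rewrite mulrBl E; by field.
(* Continuity makes [|L h|] so small that the quadratic error of [cexp] is at most [|L h| / 2];
   hence [|L h|] is at most twice [|cexp (L h) - 1|], which is [|h| / |w|]. *)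
have oL : bigO0 1 L.
  have := bigO0D (bigO0_le (isT : (2 <= 3)%N) (@cexp_taylor0 R)) (bigO0Z (2^-1) (@bigO0X R 2)).
  move=> [M [r [M0 r0 H]]].
  have M1 : 0 < 2 * M + 1 by lra.
  have m0 : 0 < Num.min r (2 * M + 1)^-1 by rewrite lt_min r0 invr_gt0.
  have [r' r'0 H'] := clog_continuous ww m0.
  exists (2 * (N w)^-1), (Num.min rs r'); split=> [||h].
  - by rewrite mulr_ge0// invr_ge0 ltW.
  - by rewrite lt_min rs0.
  rewrite lt_min => /andP[/eL Eh /H']; rewrite -/(L h) lt_min => /andP[/H].
  have -> : 2 * (N w)^-1 * N h ^+ 1 = 2 * N (cexp (L h) - 1).
    by rewrite Eh cabsM cabsV expr1 mulrA.
  have -> : cexp (L h) - 1 - L h - L h ^+ 2 / 2 + 2^-1 * L h ^+ 2 = cexp (L h) - 1 - L h by field.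
  move=> h1; rewrite -[ltRHS]mul1r ltr_pdivlMr// => h2.
  have := cabs_triB (cexp (L h) - 1) (cexp (L h) - 1 - L h).
  rewrite subKr; have := cabs_ge0 (L h); nra.
have oE : bigO0 3 (fun h => cexp (L h) - 1 - L h - L h ^+ 2 / 2) by exact: (bigO0_comp (@cexp_taylor0 R) oL).
have oLL := bigO0Z (2^-1) (bigO0M oL oL).
have o2 := bigO0D (bigO0_le (isT : (2 <= 3)%N) oE) oLL.
have o1 := bigO0D (bigO0_le (isT : (1 <= 2)%N) o2) (bigO0Z 2 oL).
have o3 := bigO0D (bigO0Z (-1) oE) (bigO0Z (2^-1) (bigO0M o2 o1)).
exists (w^-1), (- (w ^- 2) / 2); apply: (bigO0_near rs0 _ o3) => h /eL Eh.
have -> : clog (w + h) - clog w - w^-1 * h - - w ^- 2 / 2 * h ^+ 2 =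
  L h - (w^-1 * h) + 2^-1 * (w^-1 * h) ^+ 2 by rewrite /L; field.
by rewrite -Eh; field.
Qed.

End ComplexLogarithm.

(** * Integrals of bounded complex-valued functions *)

Section BoundedComplexIntegral.
Variables (R : realType) (nu : probability R R) (K : set R).
Hypothesis mK : measurable K.
Implicit Types g : R -> R[i].

Lemma measurable_inv : measurable_fun [set: R] (@GRing.inv R).
Proof.
rewrite -(setvU [set (0 : R)]).
apply/measurable_funU; [exact: measurableC|exact: measurable_set1|split].
  apply: open_continuous_measurable_fun.
    by apply: closed_openC; apply: accessible_closed_set1; apply: hausdorff_accessible; exact: norm_hausdorff.
  by move=> x; rewrite inE /= => /eqP x0; exact: inv_continuous.
exact: measurable_fun_set1.
Qed.

Definition bounded_mfun g := [/\ measurable_fun K (fun s => complex.Re (g s)),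
  measurable_fun K (fun s => complex.Im (g s)) &
  exists M, forall s, K s -> N (g s) <= M].

Lemma integrable_bounded (f : R -> R) (M : R) : measurable_fun K f ->
  (forall s, K s -> `|f s| <= M) -> nu.-integrable K (EFin \o f).
Proof.
move=> mf fM; apply: measurable_bounded_integrable => //.
  by apply: le_lt_trans (probability_le1 _ mK) _; rewrite ltry.
by exists M; split; [exact: num_real | move=> x Mx y Ky; exact: le_trans (fM y Ky) (ltW Mx)].
Qed.

Lemma bounded_mfun_integrable g : bounded_mfun g ->
  nu.-integrable K (EFin \o (fun s => complex.Re (g s))) /\
  nu.-integrable K (EFin \o (fun s => complex.Im (g s))).
Proof.
move=> [mr mi [M gM]]; split; apply: (@integrable_bounded _ M) => // s /gM; apply: le_trans.
  exact: cabs_Re.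
exact: cabs_Im.
Qed.

Lemma bounded_mfun_cst (c : R[i]) : bounded_mfun (fun=> c).
Proof. by split; [exact: measurable_cst | exact: measurable_cst | exists (N c)]. Qed.

Lemma bounded_mfunD g1 g2 : bounded_mfun g1 -> bounded_mfun g2 ->
  bounded_mfun (fun s => g1 s + g2 s).
Proof.
move=> [r1 i1 [M1 g1M]] [r2 i2 [M2 g2M]]; split.
- under eq_fun do rewrite raddfD /=; exact: measurable_funD.
- under eq_fun do rewrite raddfD /=; exact: measurable_funD.
- exists (M1 + M2) => s Ks; apply: le_trans (cabs_tri _ _) _.
  by rewrite lerD ?g1M ?g2M.
Qed.

Lemma Re_mul (z w : R[i]) : complex.Re (z * w) =
  complex.Re z * complex.Re w - complex.Im z * complex.Im w.
Proof. by case: z w => [? ?] [? ?]. Qed.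

Lemma Im_mul (z w : R[i]) : complex.Im (z * w) =
  complex.Re z * complex.Im w + complex.Im z * complex.Re w.
Proof. by case: z w => [? ?] [? ?]. Qed.

Lemma bounded_mfunM g1 g2 : bounded_mfun g1 -> bounded_mfun g2 ->
  bounded_mfun (fun s => g1 s * g2 s).
Proof.
move=> [r1 i1 [M1 g1M]] [r2 i2 [M2 g2M]]; split.
- under eq_fun do rewrite Re_mul.
  by apply: measurable_funB; exact: measurable_funM.
- under eq_fun do rewrite Im_mul.
  by apply: measurable_funD; exact: measurable_funM.
- exists (M1 * M2) => s Ks; rewrite cabsM.
  by apply: ler_pM; rewrite ?cabs_ge0 ?g1M ?g2M.
Qed.

Definition cint g : R[i] :=
  Rintegral nu K (fun s => complex.Re (g s)) +i* Rintegral nu K (fun s => complex.Im (g s)).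

Lemma cintD g1 g2 : bounded_mfun g1 -> bounded_mfun g2 ->
  cint (fun s => g1 s + g2 s) = cint g1 + cint g2.
Proof.
move=> /bounded_mfun_integrable[r1 i1] /bounded_mfun_integrable[r2 i2].
by rewrite /cint; apply/eqP; rewrite eq_complex /=; apply/andP; split; apply/eqP;
  rewrite -RintegralD//; apply: eq_Rintegral => s _; case: (g1 s) (g2 s) => [? ?] [? ?].
Qed.

Lemma cintZ c g : bounded_mfun g -> cint (fun s => c * g s) = c * cint g.
Proof.
move=> gb; have [r i] := bounded_mfun_integrable gb.
have sc (a : R) (f : R -> R) : nu.-integrable K (EFin \o f) ->
    nu.-integrable K (EFin \o (fun s => a * f s)).
  by move=> /(integrableZl mK a); apply: eq_integrable.
rewrite /cint; apply/eqP; rewrite eq_complex Re_mul Im_mul /=; apply/andP; split; apply/eqP.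
  rewrite -!RintegralZl// -RintegralB//; try exact: sc.
  by apply: eq_Rintegral => s _; rewrite Re_mul.
rewrite -!RintegralZl// -RintegralD//; try exact: sc.
by apply: eq_Rintegral => s _; rewrite Im_mul.
Qed.

Lemma Rintegral_le_bound (f : R -> R) (M : R) : measurable_fun K f ->
  (forall s, K s -> `|f s| <= M) -> 0 <= M -> `|Rintegral nu K f| <= M.
Proof.
move=> mf fM M0; apply: le_trans (le_normr_Rintegral _ _) _ => //.
  exact: integrable_bounded fM.
have : Rintegral nu K (fun s => `|f s|) <= Rintegral nu K (fun=> M).
  apply: le_Rintegral => //.
  - apply: (@integrable_bounded _ M); first exact: measurableT_comp.
    by move=> s Ks; rewrite normr_id fM.
  - by apply: (@integrable_bounded _ M) => // s _; rewrite ger0_norm.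
move/le_trans; apply; rewrite Rintegral_cst// ler_piMr//.
rewrite -lee_fin fineK ?fin_num_measure//; exact: probability_le1.
Qed.

(** The factor [2] comes from bounding the real and imaginary parts separately. *)
Lemma cabs_cint g (M : R) : bounded_mfun g -> (forall s, K s -> N (g s) <= M) ->
  0 <= M -> N (cint g) <= 2 * M.
Proof.
move=> [mr mi _] gM M0; apply: le_trans (cabs_le_ReIm _) _.
rewrite mulr_natl mulr2n lerD//; apply: Rintegral_le_bound => // s /gM; apply: le_trans.
  exact: cabs_Re.
exact: cabs_Im.
Qed.

End BoundedComplexIntegral.

(** * The function [1 + psi] of a measure carried by [K] *)

Section CauchyTransform.
Variables (R : realType) (nu : probability R R) (K : set R).
Hypotheses (mK : measurable K) (K_ge0 : forall s, K s -> 0 <= s) (nuK : nu K = 1%E).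
Implicit Types (z : R[i]) (x y s : R).

Lemma Rintegral_one : Rintegral nu K (fun=> 1) = 1.
Proof. by rewrite Rintegral_cst// mul1r; exact: (congr1 fine nuK). Qed.

(** Since [D] minus [K] is null, the integral over [[0, +oo[] in [psi] may be taken over a smaller
    carrier. *)
Lemma Rintegral_full (D : set R) (f : R -> R) (M : R) :
  measurable D -> K `<=` D -> measurable_fun D f ->
  (forall s, D s -> `|f s| <= M) -> Rintegral nu D f = Rintegral nu K f.
Proof.
move=> mD KD mf fM.
have nuD : nu D = 1%E.
  apply/le_anti/andP; split; first exact: probability_le1.
  by rewrite -nuK le_measure// inE.
have DE : D = K `|` (D `\` K) by rewrite setDUK.
have nuDK : nu (D `\` K) = 0%E.
  have fin : (nu D < +oo)%E by rewrite nuD ltry.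
  have -> : nu (D `\` K) = (nu D - nu (D `&` K))%E by exact: measureD.
  by rewrite (setIidr KD) nuD nuK subee.
have mDK : measurable (D `\` K) by exact: measurableD.
rewrite [in LHS]DE Rintegral_setU//.
- rewrite [X in _ + X](_ : _ = 0) ?addr0// /Rintegral null_set_integral//.
  by apply/measurable_EFinP; apply: measurable_funS mf => // s [].
- by rewrite -DE; exact: (integrable_bounded nu _ _ fM).
- by apply/disj_setPS => s [Ks []].
Qed.

(** A zero integral would force [f = 0] almost everywhere, leaving all the mass at [0]. *)
Lemma Rintegral_gt0 (f : R -> R) (M : R) : not_delta0 nu -> measurable_fun K f ->
  (forall s, K s -> `|f s| <= M) -> (forall s, K s -> 0 <= f s) ->
  (forall s, K s -> s != 0 -> 0 < f s) -> 0 < Rintegral nu K f.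
Proof.
move=> nd mf fM f0 fpos; rewrite lt_def Rintegral_ge0// andbT.
apply/eqP => I0; move/negP: nd; apply; apply/eqP.
have fi := integrable_bounded nu mK mf fM.
have : (\int[nu]_(s in K) `|(f s)%:E|)%E = 0%E.
  under eq_integral => s /set_mem Ks do rewrite gee0_abs ?lee_fin ?f0//.
  by rewrite -[LHS]fineK ?integrable_fin_num//; congr EFin.
move/(ae_eq_integral_abs nu mK); case.
  by apply/measurable_EFinP.
move=> A [mA A0 subA].
have KA : K `\` [set 0] `<=` A.
  move=> s [Ks /eqP s0]; apply: subA => /= /(_ Ks)[] fs0.
  by move: (fpos _ Ks s0); rewrite fs0 ltxx.
have K0 : nu (K `\` [set 0]) = 0%E.
  apply/eqP; rewrite eq_le measure_ge0 andbT -A0 le_measure ?inE//.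
  exact: measurableD.
apply/eqP; rewrite eq_le probability_le1//=.
have E : nu K = (nu (K `\` [set 0%R]) + nu (K `&` [set 0%R]))%E.
  by apply: measureDI => //; exact: measurable_set1.
rewrite -nuK E K0 add0e le_measure ?inE//.
exact: measurableI.
Qed.

Lemma Rintegral_lt (f g : R -> R) (M : R) : not_delta0 nu ->
  measurable_fun K f -> measurable_fun K g ->
  (forall s, K s -> `|f s| <= M) -> (forall s, K s -> `|g s| <= M) ->
  (forall s, K s -> f s <= g s) ->
  (forall s, K s -> s != 0 -> f s < g s) -> Rintegral nu K f < Rintegral nu K g.
Proof.
move=> nd mf mg fM gM fg fg'; rewrite -subr_gt0 -RintegralB//.
- apply: (@Rintegral_gt0 _ (M + M)) => //; first exact: measurable_funB.
  + by move=> s Ks; apply: le_trans (ler_normB _ _) _; rewrite lerD ?fM ?gM.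
  + by move=> s Ks; rewrite subr_ge0 fg.
  + by move=> s Ks s0; rewrite subr_gt0 fg'.
- exact: (integrable_bounded nu _ _ gM).
- exact: (integrable_bounded nu _ _ fM).
Qed.

Definition kern z s : R[i] := (1 - z * s%:C)^-1.
(** This is [1 + psi] at a complex argument. *)
Definition transform z : R[i] := cint nu K (kern z).
(** The growth in [1 + s] bounds not only the kernel but also [s] times the kernel, although [K] may
    be unbounded. *)
Definition separated z := exists2 c : R, 0 < c &
  forall s, K s -> c * (1 + s) <= N (1 - z * s%:C).

Lemma Re_inv z : complex.Re z^-1 = complex.Re z / (complex.Re z ^+ 2 + complex.Im z ^+ 2).
Proof. by case: z. Qed.

Lemma Im_inv z : complex.Im z^-1 = - complex.Im z / (complex.Re z ^+ 2 + complex.Im z ^+ 2).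
Proof. by case: z => a b /=; rewrite mulNr. Qed.

Lemma separated_neq0 z s : separated z -> K s -> 1 - z * s%:C != 0.
Proof.
move=> [c c0 H] Ks; rewrite -cabs_gt0; apply: lt_le_trans (H _ Ks).
by have := K_ge0 Ks => s0; rewrite mulr_gt0//; lra.
Qed.

Lemma cabs_kern z s (c : R) : 0 < c -> K s -> c * (1 + s) <= N (1 - z * s%:C) ->
  N (kern z s) <= c^-1.
Proof.
move=> c0 Ks H; have s0 := K_ge0 Ks.
rewrite /kern cabsV lef_pV2 ?posrE//.
  by apply: le_trans H; rewrite ler_peMr ?(ltW c0)//; lra.
by apply: lt_le_trans H; rewrite mulr_gt0//; lra.
Qed.

Lemma bounded_mfun_kern z : separated z -> bounded_mfun K (kern z).
Proof.
move=> [c c0 H].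
have mr : measurable_fun K (fun s => 1 - complex.Re z * s).
  by apply: measurable_funB => //; apply: measurable_funM.
have mi : measurable_fun K (fun s => - (complex.Im z * s)).
  by apply: measurable_funN; apply: measurable_funM.
have mn : measurable_fun K (fun s => ((1 - complex.Re z * s) ^+ 2 + (- (complex.Im z * s)) ^+ 2)^-1).
  apply: (measurableT_comp (@measurable_inv R)).
  by apply: measurable_funD; apply: measurable_funX.
have RE s : complex.Re (1 - z * s%:C) = 1 - complex.Re z * s.
  by case: z {H mr mi mn} => a b /=; ring.
have IE s : complex.Im (1 - z * s%:C) = - (complex.Im z * s).
  by case: z {H mr mi mn RE} => a b /=; ring.
split.
- under eq_fun do rewrite /kern Re_inv RE IE.
  exact: measurable_funM.
- under eq_fun do rewrite /kern Im_inv RE IE.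
  by apply: measurable_funM => //; exact: measurable_funN.
- by exists c^-1 => s Ks; exact: cabs_kern (H _ Ks).
Qed.

(** Integrate the finite geometric expansion of [kern (z + h)] in powers of [h * p], where
    [p s = s * kern z s] is bounded. For [z != 0], [p] is affine in the kernel and so inherits its
    measurability. *)
Lemma taylor2_transform z : z != 0 -> separated z -> taylor2 transform z.
Proof.
move=> z0 sz; have bk := bounded_mfun_kern sz.
pose p s := s%:C * kern z s.
have pE s : K s -> p s = z^-1 * (kern z s + -1).
  move=> Ks; rewrite /p /kern; field.
  by rewrite z0 separated_neq0.
have [c c0 H] := sz.
have Np s : K s -> N (p s) <= c^-1.
  move=> Ks; have s0 := K_ge0 Ks.
  rewrite /p cabsM cabs_real ger0_norm// /kern cabsV ler_pdivrMr.
    rewrite [c^-1 * _]mulrC ler_pdivlMr//; apply: le_trans (H _ Ks).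
    by rewrite mulrC ler_wpM2l ?(ltW c0)//; lra.
  by apply: lt_le_trans (H _ Ks); rewrite mulr_gt0//; lra.
have bp : bounded_mfun K p.
  have := bounded_mfunM (bounded_mfun_cst K z^-1) (bounded_mfunD bk (bounded_mfun_cst K (-1))).
  case=> m1 m2 _; split.
  - by apply: eq_measurable_fun m1 => s /set_mem /pE ->.
  - by apply: eq_measurable_fun m2 => s /set_mem /pE ->.
  - by exists c^-1.
exists (cint nu K (fun s => p s * kern z s)), (cint nu K (fun s => p s * (p s * kern z s))).
have b1 := bounded_mfunM bp bk; have b2 := bounded_mfunM bp b1.
exists (2 * (c^-1 * (c^-1 * (c^-1 * (c / 2)^-1)))), (c / 2); split=> [||h hc].
- by rewrite !mulr_ge0 ?invr_ge0 ?divr_ge0 ?ltW.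
- by rewrite divr_gt0.
have H' s : K s -> c / 2 * (1 + s) <= N (1 - (z + h) * s%:C).
  move=> Ks; have s0 := K_ge0 Ks; have := H _ Ks.
  have := cabs_tri (1 - (z + h) * s%:C) (h * s%:C).
  have -> : 1 - (z + h) * s%:C + h * s%:C = 1 - z * s%:C by ring.
  rewrite cabsM cabs_real ger0_norm//.
  have : N h * s <= c / 2 * s by rewrite ler_wpM2r// ltW.
  lra.
have c20 : 0 < c / 2 by rewrite divr_gt0.
have sz' : separated (z + h) by exists (c / 2).
have bk' := bounded_mfun_kern sz'.
have b3 := bounded_mfunM bp (bounded_mfunM bp (bounded_mfunM bp bk')).
have E : transform (z + h) = transform z + h * cint nu K (fun s => p s * kern z s)
  + h ^+ 2 * cint nu K (fun s => p s * (p s * kern z s))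
  + h ^+ 3 * cint nu K (fun s => p s * (p s * (p s * kern (z + h) s))).
  have bc d := bounded_mfunM (bounded_mfun_cst K d).
  rewrite -!cintZ// -!cintD//; do ?[exact: bc | apply: bounded_mfunD]; rewrite //.
  rewrite /transform /cint; congr Complex; apply: eq_Rintegral => s /set_mem Ks; congr (_ _);
  by rewrite /p /kern; field; rewrite !separated_neq0.
have -> : transform (z + h) - transform z - cint nu K (fun s => p s * kern z s) * h
  - cint nu K (fun s => p s * (p s * kern z s)) * h ^+ 2
  = cint nu K (fun s => p s * (p s * (p s * kern (z + h) s))) * h ^+ 3.
  by rewrite E; ring.
rewrite cabsM cabsX; apply: ler_wpM2r; first by rewrite exprn_ge0 ?cabs_ge0.
clearbody p; apply: cabs_cint => // [s Ks|]; last by rewrite !mulr_ge0 ?invr_ge0 ?(ltW c0) ?(ltW c20).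
rewrite !cabsM; do 3 (apply: ler_pM; rewrite ?mulr_ge0 ?cabs_ge0 ?Np//).
exact: cabs_kern (H' _ Ks).
Qed.

(** The modulus of [1 - z s] is at least [|Im z| * s] and at least [1 - |z| * s]; adding these with
    weights [|z| + 1] and [|Im z|] produces a multiple of [1 + s]. *)
Lemma separated_Im z : complex.Im z != 0 -> separated z.
Proof.
move=> y0; have ny0 : 0 < `|complex.Im z| by rewrite normr_gt0.
pose D := (N z + `|complex.Im z| + 1) / `|complex.Im z|.
have D0 : 0 < D by rewrite divr_gt0//; have := cabs_ge0 z; lra.
exists D^-1 => [|s Ks]; first by rewrite invr_gt0.
have s0 := K_ge0 Ks; rewrite ler_pdivrMl//.
have h1 : `|complex.Im z| * s <= N (1 - z * s%:C).
  apply: le_trans (cabs_Im _); have -> : complex.Im (1 - z * s%:C) = - (complex.Im z * s).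
    by case: (z) => a b /=; ring.
  by rewrite normrN normrM (ger0_norm s0).
have h2 : 1 <= N (1 - z * s%:C) + N z * s.
  have := cabs_tri (1 - z * s%:C) (z * s%:C).
  by rewrite subrK cabs1 cabsM cabs_real (ger0_norm s0).
rewrite /D mulrAC ler_pdivlMr//.
have := cabs_ge0 z; move: h1 h2 ny0 s0.
move: (N (1 - _)) (N z) `|_| => n m y h1 h2 ny0 s0 m0.
have := ler_wpM2l m0 h1; have := ler_wpM2l (ltW ny0) h2; lra.
Qed.

Lemma separated_neg x : x < 0 -> separated x%:C.
Proof.
move=> x0; exists (Num.min 1 (- x)) => [|s Ks]; first by rewrite lt_min ltr01 oppr_gt0.
have s0 := K_ge0 Ks; have := cabs_Re (1 - x%:C * s%:C).
apply: le_trans; rewrite /= mul0r subr0; apply: le_trans (ler_norm _).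
have m1 : Num.min 1 (- x) <= 1 by rewrite ge_min lexx.
have m2 : Num.min 1 (- x) <= - x by rewrite ge_min lexx orbT.
have := ler_wpM2r s0 m2; lra.
Qed.

Lemma kern_real x s : kern x%:C s = ((1 - x * s)^-1)%:C.
Proof. by rewrite /kern fmorphV rmorphB rmorph1 rmorphM. Qed.

Definition real_transform x := Rintegral nu K (fun s => (1 - x * s)^-1).

Lemma transform_real x : transform x%:C = (real_transform x)%:C.
Proof.
rewrite /transform /cint /real_transform; congr Complex.
  by apply: eq_Rintegral => s _; rewrite kern_real.
transitivity (Rintegral nu K (fun=> 0)); last by rewrite Rintegral_cst// mul0r.
by apply: eq_Rintegral => s _; rewrite kern_real.
Qed.

Lemma real_kern x : separated x%:C -> measurable_fun K (fun s => (1 - x * s)^-1) /\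
  exists M, forall s, K s -> `|(1 - x * s)^-1| <= M.
Proof.
move=> /bounded_mfun_kern[mr _ [M kM]]; split.
  by apply: eq_measurable_fun mr => s _; rewrite kern_real.
by exists M => s /kM; rewrite kern_real cabs_real.
Qed.

(** The imaginary part of the kernel is [Im z * s / |1 - z s|^2], positive for [s > 0], and [nu]
    charges such [s]. *)
Lemma Im_transform_gt0 z : not_delta0 nu -> 0 < complex.Im z -> 0 < complex.Im (transform z).
Proof.
move=> nd z0; have sz : separated z by apply: separated_Im; rewrite gt_eqF.
have [_ mi [M kM]] := bounded_mfun_kern sz.
have IE s : complex.Im (kern z s) = complex.Im z * s /
    (complex.Re (1 - z * s%:C) ^+ 2 + complex.Im (1 - z * s%:C) ^+ 2).
  by rewrite /kern Im_inv; congr (_ / _); case: (z) => a b /=; ring.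
have pos s : K s -> 0 < complex.Re (1 - z * s%:C) ^+ 2 + complex.Im (1 - z * s%:C) ^+ 2.
  by move=> Ks; rewrite -cabs_sqr exprn_gt0// cabs_gt0 separated_neq0.
apply: (@Rintegral_gt0 _ M) => // [s /kM|s Ks|s Ks s0].
- by apply: le_trans; exact: cabs_Im.
- by rewrite IE divr_ge0 ?mulr_ge0 ?(ltW z0) ?(K_ge0 Ks) ?(ltW (pos _ Ks)).
- by rewrite IE divr_gt0 ?pos// mulr_gt0// lt_def s0 K_ge0.
Qed.

(** The integrand increases strictly in [x] at each [s > 0]; this yields the injectivity of [eta] on
    the negative axis. *)
Lemma real_transform_mono x y : not_delta0 nu -> x < y -> y < 0 ->
  real_transform x < real_transform y.
Proof.
move=> nd xy y0; have x0 := lt_trans xy y0.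
have [mx [M1 M1P]] := real_kern (separated_neg x0).
have [my [M2 M2P]] := real_kern (separated_neg y0).
have pos s w : K s -> w < 0 -> 0 < 1 - w * s.
  move=> /K_ge0 s0 w0; have : w * s <= 0 by rewrite mulr_le0_ge0// ltW.
  lra.
apply: (@Rintegral_lt _ _ (Num.max M1 M2)) => // s Ks.
- by rewrite le_max M1P.
- by rewrite le_max M2P// orbT.
- rewrite lef_pV2 ?posrE ?pos//. by rewrite lerD2l lerN2 ler_wpM2r ?K_ge0 ?ltW.
- move=> s0; rewrite ltf_pV2 ?posrE ?pos// ltrD2l ltrN2 ltr_pM2r// lt_def s0 K_ge0//.
Qed.

(** For [s > 0] the integrand lies strictly between [0] and [1]. It follows that [eta], which is
    [1 - 1 / real_transform], is negative on the negative axis. *)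
Lemma real_transform_neg x : not_delta0 nu -> x < 0 -> 0 < real_transform x < 1.
Proof.
move=> nd x0; have [mx [M1 M1P]] := real_kern (separated_neg x0).
have pos s : K s -> 0 < 1 - x * s.
  move=> /K_ge0 s0; have : x * s <= 0 by rewrite mulr_le0_ge0// ltW.
  lra.
apply/andP; split.
  apply: (@Rintegral_gt0 _ M1) => // s Ks; last by rewrite invr_gt0 pos.
  by rewrite invr_ge0 ltW// pos.
rewrite -Rintegral_one; apply: (@Rintegral_lt _ _ (Num.max M1 1)) => // s Ks.
- by rewrite le_max M1P.
- by rewrite normr1 le_max lexx orbT.
- rewrite invf_le1 ?pos// lerDl oppr_ge0 mulr_le0_ge0 ?K_ge0 ?ltW//.
- move=> s0; rewrite invf_lt1 ?pos// ltrDl oppr_gt0 nmulr_rlt0// lt_def s0 K_ge0//.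
Qed.

Lemma psi_transform x : x < 0 -> psi nu x = real_transform x - 1.
Proof.
move=> x0; have [mx [M1 M1P]] := real_kern (separated_neg x0).
have pos s : 0 <= s -> 0 < 1 - x * s.
  move=> s0; have : x * s <= 0 by rewrite mulr_le0_ge0// ltW.
  lra.
rewrite /psi (@Rintegral_full _ _ 1).
- rewrite /real_transform -[X in _ - X]Rintegral_one -RintegralB//.
  + apply: eq_Rintegral => s /set_mem /K_ge0 /pos p0.
    by field; rewrite gt_eqF.
  + exact: (integrable_bounded nu _ _ M1P).
  + by apply: (@integrable_bounded _ _ _ mK _ 1) => // s _; rewrite normr1.
- exact: measurable_itv.
- by move=> s /K_ge0 s0; rewrite /= in_itv /= s0.
- apply: measurable_funM; first exact: measurable_funM.
  apply: (measurableT_comp (@measurable_inv R)).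
  by apply: measurable_funB => //; exact: measurable_funM.
- move=> s; rewrite /= in_itv /= andbT => s0; have p0 := pos _ s0.
  rewrite normrM normfV (gtr0_norm p0) ler_pdivrMr// mul1r ler0_norm ?mulr_le0_ge0 ?(ltW x0)//.
  lra.
Qed.

Lemma eta_transform x : not_delta0 nu -> x < 0 -> Defs.eta nu x = 1 - (real_transform x)^-1.
Proof.
move=> nd x0; have /andP[b0 _] := real_transform_neg nd x0.
by rewrite /Defs.eta psi_transform// [1 + _]addrC subrK mulrBl mul1r divff// gt_eqF.
Qed.

End CauchyTransform.

(** * Behaviour of [1 + psi] across a gap between two atoms *)

Section SpectralGap.
Variables (R : realType) (nu : probability R R) (K : set R) (a b : R).
Hypotheses (mK : measurable K) (K_ge0 : forall s, K s -> 0 <= s) (nuK : nu K = 1%E).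
Hypotheses (a0 : 0 <= a) (ab : a < b) (Ka : K a) (Kb : K b).
Hypothesis K_gap : forall s, K s -> s <= a \/ b <= s.
Implicit Types x s : R.

(** The interval []1/b, 1/a[], written without inverses so that [a = 0] means no upper bound. *)
Definition in_gap x := [/\ 0 < x, 0 < 1 - x * a & 0 < x * b - 1].

(** For [s <= a] one has [1 - x s >= 1 - x a]; for [s >= b] the quotient [(x s - 1) / (1 + s)]
    increases with [s], so its value at [b] is a lower bound. *)
Lemma separated_gap x : in_gap x -> separated K x%:C.
Proof.
move=> [x0 xa xb]; have b0 : 0 <= b by apply: ltW; exact: le_lt_trans ab.
pose c := Num.min ((1 - x * a) / (1 + a)) ((x * b - 1) / (1 + b)).
have a1 : 0 < 1 + a by rewrite ltr_wpDr.
have b1 : 0 < 1 + b by rewrite ltr_wpDr.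
exists c => [|s Ks]; first by rewrite lt_min !divr_gt0.
have s0 := K_ge0 Ks.
have ca : c * (1 + a) <= 1 - x * a by rewrite -ler_pdivlMr// ge_min lexx.
have cb : c * (1 + b) <= x * b - 1 by rewrite -ler_pdivlMr// ge_min lexx orbT.
have cp : 0 < c by rewrite lt_min !divr_gt0.
clearbody c; apply: le_trans (cabs_Re _); rewrite /= mul0r subr0.
have [sa|sb] := K_gap Ks.
  apply: le_trans (ler_norm _).
  have : c * (1 + s) <= c * (1 + a) by rewrite ler_pM2l//; lra.
  have : x * s <= x * a by rewrite ler_pM2l.
  lra.
rewrite distrC; apply: le_trans (ler_norm _).
rewrite -(ler_pM2r b1).
have : c * (1 + b) * (1 + s) <= (x * b - 1) * (1 + s) by rewrite ler_pM2r//; lra.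
have : 0 <= (s - b) * (1 + x) by rewrite mulr_ge0//; lra.
nra.
Qed.

Lemma Rintegral_indic1 (c : R) : K c -> Rintegral nu K (\1_[set c]) = fine (nu [set c]).
Proof.
move=> Kc; rewrite /Rintegral.
have -> : (\int[nu]_(s in K) (\1_[set c] s)%:E)%E = nu ([set c] `&` K).
  by apply: integral_indic => //; exact: (measurable_set1 c).
by congr (fine (nu _)); apply/seteqP; split=> s /= => [[]|->].
Qed.

Lemma indic_measurable (c : R) : measurable_fun K (\1_[set c] : R -> R).
Proof. by apply: measurable_indic; exact: (measurable_set1 c). Qed.

Lemma indic_integrable (c d e : R) :
  nu.-integrable K (EFin \o (fun s => c * \1_[set e] s + d)) .
Proof.
apply: (@integrable_bounded _ _ _ mK _ (`|c| + `|d|)).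
  apply: measurable_funD => //; apply: measurable_funM => //; exact: indic_measurable.
move=> s _; apply: le_trans (ler_normD _ _) _; rewrite lerD2r normrM ler_piMr//.
by rewrite indicE; case: (_ \in _); rewrite ?normr1 ?normr0.
Qed.

Lemma Rintegral_affine_indic (c d e : R) : K e ->
  Rintegral nu K (fun s => c * \1_[set e] s + d) = c * fine (nu [set e]) + d.
Proof.
move=> Ke.
have i1 : nu.-integrable K (EFin \o (\1_[set e] : R -> R)).
  have := indic_integrable 1 0 e; apply: eq_integrable => // s _ /=.
  by rewrite mul1r addr0.
have i2 : nu.-integrable K (EFin \o (fun s => c * \1_[set e] s)).
  have := indic_integrable c 0 e; apply: eq_integrable => // s _ /=.
  by rewrite addr0.
have i3 : nu.-integrable K (EFin \o (fun _ : R => d)).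
  have := indic_integrable 0 d e; apply: eq_integrable => // s _ /=.
  by rewrite mul0r add0r.
rewrite RintegralD// RintegralZl// Rintegral_indic1// Rintegral_cst//.
by congr (_ + _); rewrite (congr1 fine nuK : fine _ = 1) mulr1.
Qed.

(** The atom at [a] contributes exactly; the integrand is nonnegative on the rest of the part left
    of [a] and at least [- (x * b - 1)^-1] beyond the gap. *)
Lemma real_transform_gap_ge x : in_gap x ->
  fine (nu [set a]) / (1 - x * a) - (x * b - 1)^-1 <= real_transform nu K x.
Proof.
move=> xg; have [mx [M xM]] := real_kern K_ge0 (separated_gap xg).
case: xg => x0 xa xb.
rewrite mulrC -Rintegral_affine_indic//; apply: le_Rintegral => //.
- exact: indic_integrable.
- exact: (integrable_bounded nu _ _ xM).
move=> s Ks; rewrite indicE; have [->|sa] := eqVneq s a.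
  by rewrite mem_set//= mulr1 lerBlDr lerDl invr_ge0 ltW.
rewrite memNset /= ?mulr0 ?add0r; last exact/eqP.
have [sla|sb] := K_gap Ks.
  apply: (@le_trans _ _ 0); first by rewrite oppr_le0 invr_ge0 ltW.
  have xs : x * s <= x * a by rewrite ler_pM2l.
  by rewrite invr_ge0; lra.
have xs : x * b <= x * s by rewrite ler_pM2l.
by rewrite -[1 - x * s]opprB invrN lerN2 lef_pV2 ?posrE; lra.
Qed.

(** Mirror estimate: the atom at [b] contributes negatively, and elsewhere the integrand is at most
    [(1 - x * a)^-1]. *)
Lemma real_transform_gap_le x : in_gap x ->
  real_transform nu K x <= (1 - x * a)^-1 - fine (nu [set b]) / (x * b - 1).
Proof.
move=> xg; have [mx [M xM]] := real_kern K_ge0 (separated_gap xg).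
case: xg => x0 xa xb.
rewrite addrC [_ / _]mulrC -mulNr -Rintegral_affine_indic//; apply: le_Rintegral => //.
- exact: (integrable_bounded nu _ _ xM).
- exact: indic_integrable.
move=> s Ks; rewrite indicE; have [->|sb] := eqVneq s b.
  by rewrite mem_set//= mulr1 -invrN opprB lerDl invr_ge0 ltW.
rewrite memNset /= ?mulr0 ?add0r; last exact/eqP.
have [sla|sb'] := K_gap Ks.
  have xs : x * s <= x * a by rewrite ler_pM2l.
  by rewrite lef_pV2 ?posrE; lra.
have xs : x * b <= x * s by rewrite ler_pM2l.
apply: (@le_trans _ _ 0); last by rewrite invr_ge0 ltW.
by rewrite invr_le0; lra.
Qed.

Lemma real_transform_continuous x : x != 0 -> separated K x%:C ->
  {for x, continuous (real_transform nu K)}.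
Proof.
move=> x0 sx; apply/cvgrPdist_lt => e e0.
have xC0 : x%:C != 0 by rewrite eq_complex /= eqxx andbT.
have [r r0 H] := taylor2_continuous (taylor2_transform nu mK K_ge0 xC0 sx) e0.
apply/nbhs_ballP; exists r => // y /= xy.
have := H (y - x)%:C; rewrite cabs_real distrC => /(_ xy).
rewrite -rmorphD [x + (y - x)]addrC subrK !transform_real// -rmorphB cabs_real.
by rewrite distrC.
Qed.

(** The intermediate value theorem between a point near [1/b] and one further right. Values in []0,
    1[] are those for which [1 - 1 / real_transform] is negative. *)
Lemma gap_point : (0 < nu [set a])%E -> (0 < nu [set b])%E ->
  exists2 x, in_gap x & 0 < real_transform nu K x < 1.
Proof.
move=> na nb.
have fpos c : (0 < nu [set c])%E -> 0 < fine (nu [set c]) / 2 <= 1 / 2 /\ 0 < fine (nu [set c]).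
  move=> nc; have mc := @measurable_set1 R c.
  have le1 : fine (nu [set c]) <= 1.
    by rewrite -lee_fin fineK ?fin_num_measure//; exact: probability_le1.
  have gt0 : 0 < fine (nu [set c]).
    by rewrite fine_gt0// nc /= (le_lt_trans (probability_le1 nu mc))// ltry.
  by split=> //; apply/andP; split; lra.
have [+ ma0] := fpos _ na; have [+ mb0] := fpos _ nb.
set m := fine (nu [set b]) / 2; set n := fine (nu [set a]) / 2.
move=> /andP[m0 m1] /andP[n0 n1].
have b0 : 0 < b by exact: le_lt_trans ab.
have D0 : 0 < b + m * a by rewrite ltr_wpDr// mulr_ge0// ltW.
have D1 : 0 < a + n * b by rewrite ltr_wpDl// mulr_gt0.
(* [x0] solves [x * b - 1 = m * (1 - x * a)] and [x1] solves [1 - x * a = n * (x * b - 1)]. As [m]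
   and [n] are half the masses, the two gap bounds become [- (1 - x0 * a)^-1] and
   [(x1 * b - 1)^-1]. *)
pose x0 := (1 + m) / (b + m * a); pose x1 := (1 + n) / (a + n * b).
have x0a : 1 - x0 * a = (b - a) / (b + m * a) by rewrite /x0; field; rewrite gt_eqF.
have x0b : x0 * b - 1 = m * ((b - a) / (b + m * a)) by rewrite /x0; field; rewrite gt_eqF.
have x1a : 1 - x1 * a = n * ((b - a) / (a + n * b)) by rewrite /x1; field; rewrite gt_eqF.
have x1b : x1 * b - 1 = (b - a) / (a + n * b) by rewrite /x1; field; rewrite gt_eqF.
have d0 : 0 < (b - a) / (b + m * a) by rewrite divr_gt0// subr_gt0.
have d1 : 0 < (b - a) / (a + n * b) by rewrite divr_gt0// subr_gt0.
have g0 : in_gap x0.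
  split; [by rewrite divr_gt0// ltr_wpDr// ltW | by rewrite x0a | by rewrite x0b mulr_gt0].
have g1 : in_gap x1.
  split; [by rewrite divr_gt0// ltr_wpDr// ltW | by rewrite x1a mulr_gt0 | by rewrite x1b].
have x01 : x0 <= x1.
  rewrite /x0 /x1 ler_pdivrMr// mulrAC ler_pdivlMr//.
  have : 0 <= (b - a) * (1 - m * n).
    by rewrite mulr_ge0 ?subr_ge0 ?(ltW ab)//; nra.
  nra.
have f0 : real_transform nu K x0 < 0.
  apply: le_lt_trans (real_transform_gap_le g0) _.
  rewrite x0a x0b (_ : fine (nu [set b]) = 2 * m); last by rewrite /m; field.
  rewrite (_ : _ - _ = - ((b - a) / (b + m * a))^-1) ?oppr_lt0 ?invr_gt0//.
  by field; rewrite !gt_eqF ?subr_gt0.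
have f1 : 0 < real_transform nu K x1.
  apply: lt_le_trans (real_transform_gap_ge g1).
  rewrite x1a x1b (_ : fine (nu [set a]) = 2 * n); last by rewrite /n; field.
  rewrite (_ : _ - _ = ((b - a) / (a + n * b))^-1) ?invr_gt0//.
  by field; rewrite !gt_eqF ?subr_gt0.
have gx x : x \in `[x0, x1] -> in_gap x.
  rewrite in_itv /= => /andP[h0 h1]; case: g0 => x00 _ xb; case: g1 => _ xa _.
  split; first exact: lt_le_trans h0.
    by apply: lt_le_trans xa _; rewrite lerD2l lerN2 ler_wpM2r.
  by apply: lt_le_trans xb _; rewrite lerD2r ler_wpM2r// ltW.
pose v := Num.min (real_transform nu K x1) 1 / 2.
have v0 : 0 < v by rewrite divr_gt0// lt_min f1 ltr01.
have v1 : v < 1.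
  have : Num.min (real_transform nu K x1) 1 <= 1 by rewrite ge_min lexx orbT.
  by rewrite /v; lra.
have vf : v <= real_transform nu K x1.
  have : Num.min (real_transform nu K x1) 1 <= real_transform nu K x1 by rewrite ge_min lexx.
  by move: v0; rewrite /v; lra.
have [||x xI xv] := @IVT _ (real_transform nu K) x0 x1 v x01.
- apply: continuous_in_subspaceT => x; rewrite inE => /gx xg.
  by apply: real_transform_continuous; [case: xg => /lt0r_neq0|exact: separated_gap].
- by rewrite ge_min le_max vf orbT andbT (le_trans (ltW f0) (ltW v0)).
by exists x; [exact: gx | rewrite xv v0].
Qed.

End SpectralGap.

(** * The subordination identity in logarithmic coordinates *)

Section Subordination.
Variable R : realType.

(** The exponential lands in the upper half-plane, on the negative axis or in the lower half-plane
    according as [Im w] is below, at or above [pi]. *)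
Lemma separated_cexp (K : set R) (w : R[i]) : (forall s, K s -> 0 <= s) ->
  0 < complex.Im w < 2 * pi -> separated K (cexp w).
Proof.
move=> K0 /andP[w0 w2]; have [wpi|wpi|wpi] := ltgtP (complex.Im w) pi.
- apply: separated_Im => //; rewrite cexpE /= mulf_neq0 ?gt_eqF ?expR_gt0//.
  by rewrite sin_gt0_pi// w0.
- apply: separated_Im => //; rewrite cexpE /= mulf_neq0 ?(gt_eqF (expR_gt0 _))//.
  rewrite lt_eqF// -[complex.Im w](subrK pi) sinDpi oppr_lt0 sin_gt0_pi//.
  by apply/andP; split; lra.
- have -> : cexp w = (- expR (complex.Re w))%:C.
    by rewrite cexpE wpi cospi sinpi mulr0 mulrN1.
  by apply: separated_neg => //; rewrite oppr_lt0 expR_gt0.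
Qed.

Lemma cexp_neq0 (w : R[i]) : cexp w != 0.
Proof. by rewrite -cabs_gt0 cabs_cexp expR_gt0. Qed.

Variables (mu mut : probability R R) (K L : set R) (T : R).
Hypotheses (mK : measurable K) (K_ge0 : forall s, K s -> 0 <= s) (mutK : mut K = 1%E).
Hypotheses (mL : measurable L) (L_ge0 : forall s, L s -> 0 <= s) (muL : mu L = 1%E).
Hypotheses (hmu0 : not_delta0 mu) (hmut0 : not_delta0 mut).
Hypotheses (T0 : 0 < T) (T1 : T < 1).

Let A := transform mu L.
Let B := transform mut K.

Definition eta_log (z : R[i]) : R[i] := 1 - (B (cexp z))^-1.
(* In the variable [log z], the logarithm of the subordination function:
   [omega (z) = z ^ T * eta (z) ^ (1 - T)] with [T = 1 / t]. *)
Definition omega_log z : R[i] := T%:C * z + (1 - T)%:C * clog (eta_log z).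
(** Its vanishing is the identity [eta_mu (omega) = eta_mut], stated for [1 + psi] in place of
    [eta]. *)
Definition defect z : R[i] := A (cexp (omega_log z)) - B (cexp z).

Lemma taylor2_eta_log z : separated K (cexp z) -> B (cexp z) != 0 -> taylor2 eta_log z.
Proof.
move=> sz Bz; apply: taylor2B; first exact: taylor2_cst.
apply: (@taylor2_comp _ (@GRing.inv _) (fun z => B (cexp z))); last exact: taylor2V.
apply: (@taylor2_comp _ B (@cexp R)); first exact: taylor2_cexp.
by apply: taylor2_transform => //; exact: cexp_neq0.
Qed.

(** The imaginary part of [omega_log z] is a convex combination of one number in [[0, pi]] and one
    in []0, 2 pi[], with positive weights, so it stays in []0, 2 pi[], where [A] composed with
    [cexp] is regular. *)
Lemma taylor2_defect z : separated K (cexp z) -> B (cexp z) != 0 ->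
  complex.Re (eta_log z) < N (eta_log z) -> 0 <= complex.Im z <= pi ->
  taylor2 defect z.
Proof.
move=> sz Bz ez /andP[z0 zpi]; apply: taylor2B; last first.
  apply: (@taylor2_comp _ B (@cexp R)); first exact: taylor2_cexp.
  by apply: taylor2_transform => //; exact: cexp_neq0.
apply: (@taylor2_comp _ A (fun z => cexp (omega_log z))); last first.
  apply: taylor2_transform => //; first exact: cexp_neq0.
  apply: separated_cexp => //; rewrite /omega_log.
  have := Im_clog (eta_log z); move: (clog (eta_log z)) z0 zpi => [p q].
  case: (z) => x y /= y0 ypi /andP[q0 q2].
  rewrite !mul0r !addr0.
  have := mulr_ge0 (ltW T0) y0; have : 0 < (1 - T) * q by rewrite mulr_gt0 ?subr_gt0.
  have : (1 - T) * q < (1 - T) * (2 * pi) by rewrite ltr_pM2l ?subr_gt0.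
  have : T * y <= T * pi by rewrite ler_pM2l.
  have := mulr_gt0 T0 (pi_gt0 R).
  by move=> h1 h2 h3 h4 h5; apply/andP; split; lra.
apply: (@taylor2_comp _ (@cexp R) omega_log); last exact: taylor2_cexp.
apply: taylor2D; first by apply: taylor2Z; exact: taylor2_id.
apply: taylor2Z; apply: (@taylor2_comp _ (@clog R) eta_log); last exact: taylor2_clog.
exact: taylor2_eta_log.
Qed.

Lemma eta_log_real z (x : R) : cexp z = x%:C ->
  eta_log z = (1 - (real_transform mut K x)^-1)%:C.
Proof. by move=> zx; rewrite /eta_log zx /B transform_real// rmorphB rmorph1 fmorphV. Qed.

(** A transform value in []0, 1[] makes [eta_log z] a negative real, inside the domain of [clog].
    This serves both for negative [x] and for [x] in the gap. *)
Lemma taylor2_defect_real z (x : R) : cexp z = x%:C -> separated K x%:C ->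
  0 < real_transform mut K x < 1 -> 0 <= complex.Im z <= pi ->
  taylor2 eta_log z /\ taylor2 defect z.
Proof.
move=> zx sx /andP[b0 b1] zpi.
have Bz : B (cexp z) != 0.
  by rewrite zx /B transform_real// eq_complex /= eqxx andbT gt_eqF.
split; first by apply: taylor2_eta_log => //; rewrite zx.
apply: taylor2_defect => //; first by rewrite zx.
by rewrite (eta_log_real zx); apply: slit_neg; rewrite subr_lt0 invf_gt1.
Qed.

(** Below the line [Im z = pi], [B (cexp z)] has positive imaginary part, so [eta_log z] is not
    real; on that line [cexp z] is negative and so is [eta_log z]. *)
Lemma taylor2_defect_strip z : 0 < complex.Im z <= pi -> taylor2 defect z.
Proof.
move=> /andP[z0]; rewrite le_eqVlt => /predU1P[zpi|zpi].
  have zx : cexp z = (- expR (complex.Re z))%:C.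
    by rewrite cexpE zpi cospi sinpi mulr0 mulrN1.
  have x0 : - expR (complex.Re z) < 0 by rewrite oppr_lt0 expR_gt0.
  have [] // := taylor2_defect_real zx _ _ _.
  - exact: separated_neg.
  - exact: real_transform_neg.
  - by rewrite zpi lexx pi_ge0.
have Iz : 0 < complex.Im (cexp z) by rewrite cexpE /= mulr_gt0 ?expR_gt0 ?sin_gt0_pi// z0.
have IB : 0 < complex.Im (B (cexp z)) by exact: Im_transform_gt0.
have Bn : B (cexp z) != 0 by apply: contraTneq IB => ->; rewrite ltxx.
apply: taylor2_defect => //; last by rewrite !ltW.
  by apply: separated_Im => //; rewrite gt_eqF.
have E : complex.Im (eta_log z) = - complex.Im (B (cexp z))^-1.
  by rewrite /eta_log; case: (B _)^-1 => p q /=; rewrite sub0r.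
apply: slit_Im; rewrite E Im_inv mulNr opprK.
by rewrite mulf_neq0 ?gt_eqF// invr_gt0 -cabs_sqr exprn_gt0// cabs_gt0.
Qed.

(** Taking logarithms in the relation between the two [Sigma] values gives [ln (- x1) = T * ln (- x)
    + (1 - T) * ln (- w)]; both arguments being [pi], this says that [omega] sends [x] to [x1]. *)
Lemma defect_neg (u x1 : R) : let x := - expR u in let w := Defs.eta mut x in
  x1 < 0 -> Defs.eta mu x1 = w -> x / w = (x1 / w) `^ T^-1 ->
  defect (u +i* pi) = 0.
Proof.
move=> x w x10 ew xw.
have x0 : x < 0 by rewrite oppr_lt0 expR_gt0.
have [b0 b1] := andP (real_transform_neg mK K_ge0 mutK hmut0 x0).
have wE : w = 1 - (real_transform mut K x)^-1 by exact: eta_transform.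
have w0 : w < 0 by rewrite wE subr_lt0 invf_gt1.
have zx : cexp (u +i* pi) = x%:C by rewrite cexpE cospi sinpi mulr0 mulrN1.
have bE : real_transform mu L x1 = real_transform mut K x.
  move: ew; rewrite wE (eta_transform mL L_ge0 muL)// => /addrI /oppr_inj; exact: invr_inj.
rewrite /defect zx /B transform_real//.
suff -> : cexp (omega_log (u +i* pi)) = x1%:C by rewrite /A transform_real// bE subrr.
have lw : u - ln (- w) = T^-1 * (ln (- x1) - ln (- w)).
  have nx : 0 < - x by rewrite oppr_gt0.
  have nx1 : 0 < - x1 by rewrite oppr_gt0.
  have nw : 0 < - w by rewrite oppr_gt0.
  have -> : u = ln (- x) by rewrite /x opprK expRK.
  rewrite -!ln_div ?posrE// !invrN !mulrNN xw ln_powR//.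
rewrite /omega_log (eta_log_real zx) -wE clog_neg// cexpE /= !mul0r !subr0 !addr0.
have -> : T * pi + (1 - T) * pi = pi :> R by ring.
have -> : T * u + (1 - T) * ln (- w) = ln (- x1).
  rewrite -[u](subrK (ln (- w))) lw; field; by rewrite gt_eqF.
by rewrite cospi sinpi mulr0 mulrN1 lnK ?opprK ?posrE ?oppr_gt0.
Qed.

(** Continuation makes [defect] vanish in the open strip, and continuity extends this to [ln x] on
    its lower edge. There [omega] has argument [(1 - T) * pi], so [A] has a positive imaginary part
    while [B] is real. *)
Lemma no_negative_eta_in_gap (u0 rho x : R) : 0 < rho ->
  (forall u : R, u0 - rho <= u <= u0 + rho -> defect (u +i* pi) = 0) ->
  0 < x -> separated K x%:C -> 0 < real_transform mut K x < 1 -> False.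
Proof.
move=> rho0 F0 x0 sx bx.
have zero := strip_vanish rho0 taylor2_defect_strip F0.
have zx : cexp ((ln x)%:C) = x%:C.
  by rewrite cexpE /= cos0 sin0 mulr1 mulr0 lnK.
have [|_ tF] := taylor2_defect_real zx sx bx; first by rewrite /= lexx pi_ge0.
have Fx : defect (ln x)%:C = 0.
  apply/eqP; rewrite -[_ == _]negbK -cabs_gt0; apply/negP => F1.
  have [r r0 H] := taylor2_continuous tF F1.
  pose th := Num.min r pi / 2.
  have m0 : 0 < Num.min r pi by rewrite lt_min r0 pi_gt0.
  have m1 : Num.min r pi <= r by rewrite ge_min lexx.
  have m2 : Num.min r pi <= pi by rewrite ge_min lexx orbT.
  have := H (0 +i* th); rewrite zero /=; last by rewrite add0r /th; apply/andP; split; lra.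
  rewrite sub0r cabsN ltxx => F; suff: false by []; apply: F.
  have -> : N (0 +i* th) = `|th| by rewrite /cabs /= expr0n add0r sqrtr_sqr.
  by rewrite gtr0_norm /th; lra.
have Iw : 0 < complex.Im (cexp (omega_log (ln x)%:C)).
  have [b0 b1] := andP bx.
  have e0 : 1 - (real_transform mut K x)^-1 < 0 by rewrite subr_lt0 invf_gt1.
  rewrite /omega_log (eta_log_real zx) clog_neg// cexpE /= !mul0r !addr0 mulr0 add0r.
  have Tpi : 0 < T * pi by rewrite mulr_gt0 ?pi_gt0.
  have Tpi' : 0 < (1 - T) * pi by rewrite mulr_gt0 ?pi_gt0 ?subr_gt0.
  rewrite mulr_gt0 ?expR_gt0 ?sin_gt0_pi//; apply/andP; split; lra.
have := Im_transform_gt0 mL L_ge0 muL hmu0 Iw.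
have -> : transform mu L (cexp (omega_log (ln x)%:C)) = (real_transform mut K x)%:C.
  by apply/eqP; rewrite -subr_eq0 -transform_real// -zx; apply/eqP.
by rewrite /= ltxx.
Qed.

End Subordination.

(** * Positive mass between two atoms of [mut] *)

Theorem theorem2p5 (R : realType) (mu mut : probability R R) (t : R)
  (hmu : supported_nonneg mu) (hmu0 : not_delta0 mu)
  (hmut : supported_nonneg mut) (hmut0 : not_delta0 mut)
  (ht : 1 < t)
  (hS : exists eps : R, 0 < eps /\
          forall w : R, - eps < w -> w < 0 ->
            exists s1 s2 : R, Sigma_at mu w s1 /\ Sigma_at mut w s2 /\
                              s2 = s1 `^ t)
  (a b : R) (ha : 0 <= a) (hab : a < b)
  (hA : (0 < mut [set a])%E) (hB : (0 < mut [set b])%E) :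
  (0 < mut `]a, b[%classic)%E.
Proof.
rewrite lt0e measure_ge0 andbT; apply/eqP => gap0.
(* If the gap is null, [K] still carries [mut]; [L] serves as the carrier of [mu]. *)
pose L : set R := `[0, +oo[%classic; pose K : set R := L `\` `]a, b[%classic.
have mL : measurable L by exact: measurable_itv.
have mI : measurable (`]a, b[%classic : set R) by exact: measurable_itv.
have mK : measurable K by exact: measurableD.
have L_ge0 s : L s -> 0 <= s by rewrite /L /= in_itv /= andbT.
have K_ge0 s : K s -> 0 <= s by case=> /L_ge0.
have mutK : mut K = 1%E.
  have E : mut L = (mut K + mut (L `&` `]a, b[%classic))%E by exact: measureDI.
  have I0 : mut (L `&` `]a, b[%classic) = 0%E.
    by apply/eqP; rewrite eq_le measure_ge0 andbT -gap0 le_measure ?inE//; exact: measurableI.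
  by rewrite -[RHS]hmut -/L E I0 adde0.
have Ka : K a by split; rewrite /L /= in_itv /= ?andbT// ltxx.
have Kb : K b by split; rewrite /L /= in_itv /= ?andbT ?ltxx ?andbF// ltW// (le_lt_trans ha).
have K_gap s : K s -> s <= a \/ b <= s.
  move=> [_ /negP]; rewrite /= in_itv /= negb_and -!leNgt => /orP[]; by [left|right].
have [x xg bx] := gap_point mK K_ge0 mutK ha hab Ka Kb K_gap hA hB.
have t0 : 0 < t by exact: lt_trans ht.
have T0 : 0 < t^-1 by rewrite invr_gt0.
have T1 : t^-1 < 1 by rewrite invf_lt1.
have [eps [eps0 Heps]] := hS.
have e2 : 0 < eps / 2 by rewrite divr_gt0.
have e2n : - (eps / 2) < 0 by rewrite oppr_lt0.
have e2e : - eps < - (eps / 2) by lra.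
(* At [x2] the value of [eta mut] is [- (eps / 2)], the midpoint of []-eps, 0[]; by continuity [hS]
   applies to the values at all nearby points, which provides the segment for the continuation. *)
have [_ [_ [_ [[x2 [x20 [ex2 _]]] _]]]] := Heps _ e2e e2n.
pose u0 := ln (- x2).
have zx2 : cexp (u0 +i* pi) = x2%:C.
  by rewrite cexpE cospi sinpi mulr0 mulrN1 lnK ?opprK ?posrE ?oppr_gt0.
clearbody u0.
have [|te _] := taylor2_defect_real mu mK K_ge0 mL L_ge0 T0 T1 zx2 (separated_neg K_ge0 x20)
  (real_transform_neg mK K_ge0 mutK hmut0 x20).
  by rewrite /= lexx pi_ge0.
have [r r0 Hr] := taylor2_continuous te e2.
have r20 : 0 < r / 2 by rewrite divr_gt0.
have rr : r / 2 < r by lra.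
have [x0 _ _] := xg.
apply: (no_negative_eta_in_gap mK K_ge0 mutK mL L_ge0 hmu hmu0 hmut0 T0 T1 r20 _ x0
  (separated_gap K_ge0 ha hab K_gap xg) bx) => u /andP[ul ur].
have ur' : `|u - u0| < r.
  have {}ul : u0 - r / 2 <= u := ul; have {}ur : u <= u0 + r / 2 := ur.
  by rewrite ltr_distl; apply/andP; split; lra.
have etaE y v : y < 0 -> cexp v = y%:C -> eta_log mut K v = (Defs.eta mut y)%:C.
  by move=> y0 vy; rewrite (eta_log_real mut mK vy) (eta_transform mK K_ge0 mutK).
have xu0 : - expR u < 0 by rewrite oppr_lt0 expR_gt0.
have zu : cexp (u +i* pi) = (- expR u)%:C by rewrite cexpE cospi sinpi mulr0 mulrN1.
pose w := Defs.eta mut (- expR u).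
have we : `|w + eps / 2| < eps / 2.
  have := Hr (u - u0)%:C; rewrite cabs_real => /(_ ur').
  have -> : (u0 +i* pi) + (u - u0)%:C = u +i* pi.
    by apply/eqP; rewrite eq_complex /=; apply/andP; split; apply/eqP; ring.
  rewrite (etaE _ _ xu0 zu) (etaE _ _ x20 zx2) ex2 -rmorphB cabs_real opprK; exact.
have [wl w0] : - eps < w /\ w < 0.
  by move: we; rewrite ltr_norml => /andP[? ?]; split; lra.
have [s1 [s2 [[x1 [x10 [ex1 s1E]]] [[y [y0 [ey s2E]]] s12]]]] := Heps _ wl w0.
(* [Sigma_at] only supplies some negative preimage [y] of [w]; strict monotonicity identifies it
   with the point under study. *)
have yu : y = - expR u.
  have bE : real_transform mut K y = real_transform mut K (- expR u).
    move: ey; rewrite /w !(eta_transform mK K_ge0 mutK)// => /addrI /oppr_inj; exact: invr_inj.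
  have [lt|gt|//] := ltgtP y (- expR u).
    by have := real_transform_mono mK K_ge0 mutK hmut0 lt xu0; rewrite bE ltxx.
  by have := real_transform_mono mK K_ge0 mutK hmut0 gt y0; rewrite bE ltxx.
apply: (defect_neg mK K_ge0 mutK mL L_ge0 hmu hmu0 hmut0 T0 x10 ex1).
by rewrite invrK -/w -s1E -s12 s2E yu.
Qed.
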